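(* For each of the $3$-dimensional real Bott manifolds $M=M^3(1,0,0)$, $M^3(0,1,0)$, $M^3(0,0,1)$, $M^3(0,1,1)$, one has $5\le\mathbf{TC}(M)\le 7$.
   Context: Small covers: let $P$ be an $n$-dimensional simple polytope (exactly $n$ facets meet at each vertex) with facet set $\mathcal{F}(P)$. A characteristic function is a map $\lambda\colon \mathcal{F}(P)\to\mathbb{Z}_2^n$ such that whenever distinct facets $F_{i_1},\dots,F_{i_\ell}$ have nonempty intersection, the vectors $\lambda(F_{i_1}),\dots,\lambda(F_{i_\ell})$ generate an $\ell$-dimensional direct summand of $\mathbb{Z}_2^n$. For $p\in P$ let $F(p)=F_{i_1}\cap\cdots\cap F_{i_k}$ be the unique face containing $p$ in its relative interior, and $G_{F(p)}=\langle\lambda(F_{i_1}),\dots,\lambda(F_{i_k})\rangle$. The small cover is $M^n(P,\lambda)=(P\times\mathbb{Z}_2^n)/\sim$, where $(p,g)\sim(q,h)$ iff $p=q$ and $g^{-1}h\in G_{F(p)}$; it is a closed $n$-manifold. Real Bott manifolds and Bott matrices: take $P=\prod_{j=1}^n\Delta^1$ (the $n$-cube), with $F_0^j,F_1^j$ the two opposite facets in the $j$-th direction. Given a lower triangular $n\times n$ matrix $\tilde A$ over $\mathbb{Z}_2$ (the Bott matrix) with all diagonal entries $1$ and with entry $\beta_j^k\in\mathbb{Z}_2$ in row $k$ and column $j$ for $j<k$, define $\lambda(F_1^j)=e_j$ (the $j$-th standard basis vector) and $\lambda(F_0^j)=$ the $j$-th column of $\tilde A$, for $j=1,\dots,n$.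 The small cover $M^n(P,\lambda)$ is the real Bott manifold with Bott matrix $\tilde A$. For $n=3$, $M^3(\beta_1^2,\beta_1^3,\beta_2^3)$ denotes the real Bott manifold with Bott matrix $\begin{pmatrix}1&0&0\\ \beta_1^2&1&0\\ \beta_1^3&\beta_2^3&1\end{pmatrix}$. Topological complexity (non-normalized): for a path-connected space $Y$, let $PY$ be the space of continuous paths $\gamma\colon[0,1]\to Y$ with the compact-open topology and $\pi\colon PY\to Y\times Y$, $\pi(\gamma)=(\gamma(0),\gamma(1))$. $\mathbf{TC}(Y)$ is the least integer $k$ such that $Y\times Y$ is covered by $k$ open sets $U_1,\dots,U_k$, each admitting a continuous map $s_i\colon U_i\to PY$ with $\pi\circ s_i$ homotopic to the inclusion $U_i\hookrightarrow Y\times Y$ ($\infty$ if no such $k$ exists). *)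

(* Defs.v *)
From HB Require Import structures.
From mathcomp Require Import all_boot all_order all_algebra generic_quotient.
From mathcomp Require Import all_classical all_reals all_analysis.

Set Implicit Arguments.
Unset Strict Implicit.
Unset Printing Implicit Defensive.

Import Order.TTheory GRing.Theory Num.Theory.
Import numFieldNormedType.Exports.

Local Open Scope classical_set_scope.
Local Open Scope ring_scope.

Definition unit_itv (R : realType) : topologicalType :=
  set_type `[0 : R, 1]%classic.

Lemma unit_itv0_subproof (R : realType) : (0 : R) \in `[0 : R, 1]%classic.
Proof. by rewrite inE /= in_itv /= lexx ler01. Qed.

Lemma unit_itv1_subproof (R : realType) : (1 : R) \in `[0 : R, 1]%classic.
Proof. by rewrite inE /= in_itv /= lexx ler01. Qed.

Definition itv0 (R : realType) : unit_itv R := SigSub (unit_itv0_subproof R).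
Definition itv1 (R : realType) : unit_itv R := SigSub (unit_itv1_subproof R).

Definition homotopic (R : realType) (X Y : topologicalType) (f g : X -> Y) :=
  exists H : X * unit_itv R -> Y,
    [/\ continuous H, forall x, H (x, itv0 R) = f x
      & forall x, H (x, itv1 R) = g x].

Section PathSpace.
Variables (R : realType) (Y : topologicalType).

Definition pathSpace : Type := continuousType (unit_itv R) Y.

HB.instance Definition _ := Topological.copy pathSpace
  (initial_topology
     (id : continuousType (unit_itv R) Y -> {compact-open, unit_itv R -> Y})).

Definition path_ends (gamma : pathSpace) : Y * Y :=
  (gamma (itv0 R), gamma (itv1 R)).

Definition has_motion_planner (U : set (Y * Y)) :=
  exists s : set_type U -> pathSpace,
    continuous s /\ homotopic R (path_ends \o s) (@set_val _ U).

(* Non-normalized convention: [k] is the number of open sets, so that a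
   contractible space has [TC] equal to 1. *)
Definition motion_cover (k : nat) :=
  exists U : 'I_k -> set (Y * Y),
    [/\ forall i, open (U i), forall z, exists i, U i z
      & forall i, has_motion_planner (U i)].

Definition TC : \bar R :=
  match pselect (exists k, `[< motion_cover k >]) with
  | left ex_k => (ex_minn ex_k)%:R%:E
  | right _ => +oo%E
  end.

End PathSpace.

(* A polytope is a set [P] together with its facets, listed without repetition
   by [F : I -> set X]. *)

(* Over the field Z/2 every subspace is a direct summand, so only the dimension
   of the span is at stake. *)
Definition is_characteristic (X : Type) (P : set X) (I : finType)
    (F : I -> set X) (n : nat) (lam : I -> 'cV['F_2]_n) :=
  forall S : {set I}, (exists2 x, P x & forall i, i \in S -> F i x) ->
    \dim <<[seq lam i | i in S]>>%VS = #|S|.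

Record charFun (X : Type) (P : set X) (I : finType) (F : I -> set X)
    (n : nat) := CharFun {
  char_fun :> I -> 'cV['F_2]_n;
  char_funP : is_characteristic P F char_fun }.

Section SmallCover.
Variables (X : topologicalType) (P : set X) (I : finType) (F : I -> set X).
Variables (n : nat) (lam : charFun P F n).

(* The facets through [p]; in a simple polytope their intersection is the
   unique face F(p) having [p] in its relative interior. *)
Definition facets_at (p : X) : {set I} := [set i | `[< F i p >]].

Definition face_group (p : X) : {vspace 'cV['F_2]_n} :=
  <<[seq lam i | i in facets_at p]>>%VS.

Definition coverBase : topologicalType :=
  (set_type P * discrete_topology 'cV['F_2]_n)%type.

Definition cover_rel (u v : coverBase) : bool :=
  (u.1 == v.1)
    && ((v.2 : 'cV['F_2]_n) - (u.2 : 'cV['F_2]_n) \in face_group (set_val u.1)).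

Lemma cover_rel_refl : reflexive cover_rel.
Proof. by move=> u; rewrite /cover_rel eqxx subrr mem0v. Qed.

Lemma cover_rel_sym : symmetric cover_rel.
Proof.
move=> u v; rewrite /cover_rel [v.1 == _]eq_sym.
by case: eqP => //= ->; rewrite -memvN opprB.
Qed.

Lemma cover_rel_trans : transitive cover_rel.
Proof.
move=> v u w /andP[/eqP uv h1] /andP[/eqP vw h2].
rewrite /cover_rel uv vw eqxx /=.
move: h1; rewrite uv vw => h1; move: h2; rewrite vw => h2.
by have := memvD h2 h1; rewrite addrA subrK.
Qed.

Canonical cover_equiv :=
  EquivRel cover_rel cover_rel_refl cover_rel_sym cover_rel_trans.

Definition smallCover : topologicalType :=
  quotient_topology {eq_quot cover_equiv}%qT.

End SmallCover.

Section Cube.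
Variables (R : realType) (n : nat).

Definition cube : set 'rV[R]_n := [set x | forall j, 0 <= x 0 j <= 1].

(* [(j, false)] and [(j, true)] index the opposite facets F_0^j and F_1^j. *)
Definition cube_facet (i : 'I_n * bool) : set 'rV[R]_n :=
  [set x | cube x /\ x 0 i.1 = i.2%:R].

End Cube.

Record bottMatrix (n : nat) := BottMatrix {
  bott_mx :> 'M['F_2]_n;
  bott_mxP : is_trig_mx bott_mx && [forall j, bott_mx j j == 1] }.

Section RealBott.
Variables (R : realType) (n : nat) (A : bottMatrix n).

Definition bott_char (i : 'I_n * bool) : 'cV['F_2]_n :=
  if i.2 then delta_mx i.1 0 else col i.1 A.

Lemma bott_char_free (b : 'I_n -> bool) :
  free [seq bott_char (j, b j) | j : 'I_n].
Proof.
have /andP[/is_trig_mxP Atrig /forallP Adiag] := bott_mxP A.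
pose M : 'M['F_2]_n := \matrix_(i, j) bott_char (j, b j) i 0.
have Mtrig : is_trig_mx M.
  apply/is_trig_mxP => i j ij; rewrite mxE /bott_char /=.
  case: (b j); rewrite mxE ?Atrig //.
  by case: eqP => //= eij; rewrite eij ltnn in ij.
have Munit : M \in unitmx.
  rewrite unitmxE det_trig // big1 ?unitr1 // => i _.
  rewrite mxE /bott_char /=.
  by case: (b i); rewrite mxE ?eqxx //; apply/eqP.
have -> : [seq bott_char (j, b j) | j : 'I_n] =
    [tuple bott_char (j, b j) | j < n] :> seq _ by [].
apply/freeP => k k0 i.
have : M *m (\col_j k j) = 0.
  apply/colP => r; move/colP/(_ r): k0; rewrite !mxE summxE => k0.
  rewrite -[RHS]k0; apply: eq_bigr => j _.
  by rewrite -tnth_nth tnth_mktuple !mxE mulrC.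
move/(congr1 (mulmx (invmx M))); rewrite mulKmx // mulmx0.
by move/colP/(_ i); rewrite !mxE.
Qed.

Lemma bott_char_characteristic :
  is_characteristic (@cube R n) (@cube_facet R n) bott_char.
Proof.
move=> S [x _ xS]; pose b j := (j, false) \notin S.
have Sb i : i \in S -> i.2 = b i.1.
  case: i => j [] /= jS; rewrite /b; last by rewrite jS.
  apply/esym/negP => jS'; have [_ /= x1] := xS _ jS; have [_ /= x0] := xS _ jS'.
  by move: x1; rewrite x0 => /esym/eqP; rewrite oner_eq0.
have fr := bott_char_free b.
have lam_inj : {in S &, injective bott_char}.
  have := free_uniq fr => /injectiveP binj.
  move=> [j c] [j' c'] /[dup] /Sb /= -> _ /[dup] /Sb /= -> _ /binj -> //.
suff : free [seq bott_char i | i in S].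
  by rewrite /free size_map -cardE => /eqP.
have uS : uniq [seq bott_char i | i in S].
  by rewrite map_inj_in_uniq ?enum_uniq // => i j;
     rewrite !mem_enum; apply: lam_inj.
rewrite -(perm_free (X := seq.filter (mem [seq bott_char i | i in S])
  [seq bott_char (j, b j) | j : 'I_n])) ?filter_free //.
apply: uniq_perm => //; first by rewrite filter_uniq // free_uniq.
move=> v; rewrite mem_filter andb_idr // => /mapP[[j c]].
rewrite mem_enum => /Sb /= -> ->.
by apply/mapP; exists j; rewrite ?mem_enum.
Qed.

Definition realBott : topologicalType :=
  smallCover (CharFun bott_char_characteristic).

End RealBott.

Section RealBott3.
Variables b12 b13 b23 : 'F_2.

Definition bott3_mx : 'M['F_2]_3 :=
  \matrix_(i < 3, j < 3)
    nth 0 (nth [::] [:: [:: 1;   0;   0];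
                        [:: b12; 1;   0];
                        [:: b13; b23; 1]] i) j.

Lemma bott3_mxP : is_trig_mx bott3_mx && [forall j, bott3_mx j j == 1].
Proof.
apply/andP; split.
  by apply/is_trig_mxP => -[[|[|[|?]]] ?] // -[[|[|[|?]]] ?] //; rewrite mxE.
by apply/forallP => -[[|[|[|?]]] ?] //; rewrite mxE.
Qed.

End RealBott3.

(* [bjk] stands for beta_j^k, the entry in row k and column j. *)
Definition M3 (R : realType) (b12 b13 b23 : 'F_2) : topologicalType :=
  realBott R (BottMatrix (bott3_mxP b12 b13 b23)).

(* Main.v *)
(** Upper bound: a real Bott manifold M of dimension n folds onto the n-cube. On
    the part of [M * M] where the coordinates in a set J are strictly closer to an
    end of [[0, 1]] than the others, push the coordinates in J to that end and
    the others to 1/2: the inclusion of this open set is null-homotopic. These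
    sets are disjoint for J of fixed size, so 2n + 1 unions of them suffice.

    Lower bound: in suitable coordinates, each of the four manifolds is a Klein
    bottle times a circle. On an open set with a motion planner the two
    projections are homotopic, so the zero-divisor [x (x) 1 - 1 (x) x] of a mod 2
    class x of degree 1 vanishes there. For y, x, z the fibre, base and circle
    classes, the product of the zero-divisors of y, y, x, z is nonzero: it is
    detected on a Klein bottle times a torus, glued from a 4-cube. Each class comes
    from a line bundle; its vanishing on an open set is witnessed by a sign
    function on part of the 4-cube, obtained by transporting lines along paths,
    and the nonvanishing of the product is a cup product computation on a fine
    grid. *)

From HB Require Import structures.
Require Import Defs.
From mathcomp Require Import all_boot all_order all_algebra generic_quotient.
From mathcomp Require Import all_classical all_reals all_analysis.
From mathcomp Require Import zify ring lra.
From Stdlib Require List.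

Set Implicit Arguments.
Unset Strict Implicit.
Unset Printing Implicit Defensive.
Import Order.TTheory GRing.Theory Num.Theory.
Import numFieldNormedType.Exports.
Local Open Scope classical_set_scope.
Local Open Scope ring_scope.

(** * Mod 2 cup products on a grid *)

(** Only y can be used twice: x and z come from circles and square to zero, while y^2 is nonzero on
    the Klein bottle. The torus lies where the fibre coordinate is 0, so y is trivial on it, and the
    four zero-divisors restrict to y (x) 1, y (x) 1, x (x) 1 + 1 (x) x and 1 (x) z; their product is
    y^2 (x) xz. Relative cup products are replaced by an argument cell by cell. If four sets with
    motion planners covered everything, each cell of a fine grid would map into one of them, where
    the corresponding sign function is constant; this kills the contribution of the cell, so all
    contributions would sum to 0. But the jumps of the four functions across the gluings alone force
    the sum to be 1. A single number [N] sets both the mesh of the grid and the number of transport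
    steps along a planner path. *)

Lemma addF2 (x : 'F_2) : x + x = 0.
Proof. by case: x => [[|[|?]]] // ?; apply/eqP. Qed.

Section GridCup.
Variable I : eqType.
Implicit Types (p q : I -> nat) (j k : I) (J : seq I) (F : (I -> nat) -> 'F_2).

Definition upd p j x : I -> nat := fun k => if k == j then x else p k.

(** Cells have width 2, so that the centres of all faces of a cell are again grid points. In the
    cells summed over later, the centre is odd in the directions of the cell and the predecessor
    never truncates. *)
Definition gdiff j F p : 'F_2 := F (upd p j (p j).+1) + F (upd p j (p j).-1).

Lemma gdiffE j F p :
  gdiff j F p = F (upd p j (p j).+1) + F (upd p j (p j).-1).
Proof. by []. Qed.

(* [cup [:: f_d; ...; f_1] J p] is the value, on the cell with centre [p] and
   the [d] directions [J], of the cup product of the coboundaries of [f_1], ...,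
   [f_d] summed over the flags of that cell. By [cup_sphere], [f_d] itself can
   stand for its coboundary. *)
Fixpoint cup (fs : seq ((I -> nat) -> 'F_2)) J p : 'F_2 :=
  if fs is f :: fs' then
    \sum_(j <- J) gdiff j (fun q => f q * cup fs' [seq k <- J | k != j] q) p
  else 1.

Arguments cup : simpl never.

Lemma cup_cons f fs J p : cup (f :: fs) J p =
  \sum_(j <- J) gdiff j (fun q => f q * cup fs [seq k <- J | k != j] q) p.
Proof. by []. Qed.

Lemma upd_neq p j k x : k != j -> upd p j x k = p k.
Proof. by rewrite /upd => /negbTE ->. Qed.

Lemma upd_eq p j x : upd p j x j = x.
Proof. by rewrite /upd eqxx. Qed.

Lemma upd_upd p j x y : upd (upd p j x) j y = upd p j y.
Proof. by apply/funext => k; rewrite /upd; case: eqP. Qed.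

Lemma updC p j k x y : j != k -> upd (upd p j x) k y = upd (upd p k y) j x.
Proof.
move=> jk; apply/funext => l; rewrite /upd.
by case: eqVneq => // ->; rewrite eq_sym (negbTE jk).
Qed.

Lemma gdiffC j k F p : j != k -> gdiff j (gdiff k F) p = gdiff k (gdiff j F) p.
Proof.
move=> jk; have kj : k != j by rewrite eq_sym.
by rewrite /gdiff !upd_neq // ![upd (upd p k _) j _]updC // addrACA.
Qed.

Lemma gdiff_sum j (r : seq I) (P : pred I) (G : I -> (I -> nat) -> 'F_2) p :
  gdiff j (fun q => \sum_(k <- r | P k) G k q) p =
  \sum_(k <- r | P k) gdiff j (G k) p.
Proof. by rewrite /gdiff -big_split. Qed.

Lemma sum_offdiag_sym J (S : I -> I -> 'F_2) :
  (forall j k, S j k = S k j) ->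
  \sum_(j <- J) \sum_(k <- J | k != j) S j k = 0.
Proof.
move=> SC; elim: J => [|x J IH]; first by rewrite big_nil.
rewrite big_cons big_cons eqxx /=.
have -> : \sum_(j <- J) \sum_(k <- x :: J | k != j) S j k =
    \sum_(j <- J | j != x) S x j + \sum_(j <- J) \sum_(k <- J | k != j) S j k.
  rewrite [X in X + _]big_mkcond -big_split; apply: eq_bigr => j _ /=.
  by rewrite big_cons eq_sym; case: ifP => // _; [rewrite SC|rewrite add0r].
by rewrite IH addr0 addF2.
Qed.

(* The boundary of a cell is a closed sphere, so a cup product of coboundaries
   sums to zero on it. *)
Lemma cup_sphere fs J p :
  \sum_(j <- J) gdiff j (cup fs [seq k <- J | k != j]) p = 0.
Proof.
case: fs => [|f fs]; first by rewrite big1 // => j _; exact: addF2.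
under eq_bigr do rewrite gdiff_sum big_filter.
pose S j k := if j == k then 0 else
  gdiff j (gdiff k (fun q => f q *
    cup fs [seq l <- J | (l != k) && (l != j)] q)) p.
rewrite -[RHS](sum_offdiag_sym J (S := S)); last first.
  move=> j k; rewrite /S [k == j]eq_sym; case: eqVneq => // jk.
  rewrite gdiffC //; do 2 congr (gdiff _ _ _); apply/funext => q.
  by congr (_ * cup _ _ _); apply: eq_filter => l; rewrite andbC.
apply: eq_bigr => j _; apply: eq_bigr => k kj.
rewrite /S eq_sym (negbTE kj); do 2 congr (gdiff _ _ _); apply/funext => q.
by rewrite -filter_predI.
Qed.

Definition in_cell J p q :=
  forall k, if k \in J then (q k <= (p k).+1)%N /\ (p k <= (q k).+1)%N
            else q k = p k.

Lemma in_cell_face j J p x q : j \in J -> (x <= (p j).+1)%N ->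
  (p j <= x.+1)%N -> in_cell [seq k <- J | k != j] (upd p j x) q ->
  in_cell J p q.
Proof.
move=> jJ x1 x2 H k; have := H k; rewrite mem_filter /upd.
by case: eqVneq => [-> /= ->|kj]; first rewrite jJ.
Qed.

(** A constant first factor comes out of the boundary sum, which vanishes by [cup_sphere]. A
    constant later factor kills the inner product on every face, since faces lie in the cell. *)
Lemma cup_const fs x J p :
  List.Exists (fun f => forall q, in_cell J p q -> f q = x) fs ->
  cup fs J p = 0.
Proof.
have face J' p' (j : I) (y : nat) : j \in J' ->
    (y == (p' j).+1) || (y == (p' j).-1) ->
    forall q, in_cell [seq k <- J' | k != j] (upd p' j y) q -> in_cell J' p' q.
  by move=> jJ yj q; apply: in_cell_face => //; lia.
have self (l : I) (K : seq I) p' (y : nat) : in_cell K (upd p' l y) (upd p' l y).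
  by move=> k; case: ifP => _; split; rewrite ?leqnSn.
elim: fs J p => [|f fs IH] J p; first by move/List.Exists_nil.
rewrite cup_cons => /List.Exists_cons[fx|fsx].
  rewrite -[RHS](mulr0 x) -[in RHS](cup_sphere fs J p) mulr_sumr.
  apply: eq_big_seq => j jJ; rewrite /gdiff mulrDr.
  by congr (_ * _ + _ * _); apply/fx/(face J p j) => //; rewrite eqxx ?orbT.
apply: big1_seq => j /andP[_ jJ]; rewrite /gdiff.
by rewrite !IH ?mulr0 ?addr0 //; apply: List.Exists_impl fsx => g gx q qJ;
  apply/gx/(face _ _ _ _ jJ _ _ qJ); rewrite eqxx ?orbT.
Qed.

Definition interior_at n J p := forall j, j \in J -> (0 < p j < n)%N.

Definition in_box n p := forall j, (p j <= n)%N.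

(** A jump that is constant along the glued face contributes that constant times a boundary sum,
    which vanishes by [cup_sphere]. The hypothesis on [gdiff] lets [rho] reverse a direction, which
    is invisible mod 2. *)
Lemma cup_glue n s (rho : (I -> nat) -> I -> nat)
    (fs : seq ((I -> nat) -> 'F_2)) J p :
  (forall j F q, j != s -> (0 < q j < n)%N ->
     gdiff j F (rho q) = gdiff j (F \o rho) q) ->
  List.Forall (fun f => exists chi, forall q, in_box n q -> q s = n ->
     f q = f (rho q) + chi) fs ->
  s \notin J -> interior_at n J p -> in_box n p -> p s = n ->
  cup fs J p = cup fs J (rho p).
Proof.
move=> rhoD glue; elim: glue J p => [//|{}f {}fs [k fk] _ IH] J p sJ pJ pn ps.
rewrite !cup_cons -[LHS]addr0 -[X in _ + X](mulr0 k) -[X in k * X](cup_sphere fs J p).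
rewrite mulr_sumr -big_split; apply: eq_big_seq => j jJ /=.
have js : j != s by apply: contraNneq sJ => <-.
have pj := pJ j jJ.
have step x : (x <= n)%N ->
    f (rho (upd p j x)) * cup fs [seq l <- J | l != j] (rho (upd p j x)) =
    (f (upd p j x) + k) * cup fs [seq l <- J | l != j] (upd p j x).
  move=> xn.
  have un : in_box n (upd p j x) by move=> l; rewrite /upd; case: eqP.
  have us : upd p j x s = n by rewrite /upd eq_sym (negbTE js).
  rewrite -IH //; last 2 first.
  - by rewrite mem_filter (negbTE sJ) andbF.
  - by move=> l; rewrite mem_filter /upd => /andP[/negbTE -> /pJ].
  by rewrite (fk _ un us) -addrA addF2 addr0.
rewrite rhoD // !gdiffE /=.
rewrite (step (p j).+1) ?(step (p j).-1); [|lia..].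
ring.
Qed.

End GridCup.

(** * The grid on the product of a Klein bottle and a torus *)

Definition pt4 a b c d : nat -> nat := fun k => nth 0 [:: a; b; c; d] k.

Lemma upd0_pt4 a b c d x : upd (pt4 a b c d) 0%N x = pt4 x b c d.
Proof. by apply/funext => -[|[|[|[|?]]]]. Qed.
Lemma upd1_pt4 a b c d x : upd (pt4 a b c d) 1%N x = pt4 a x c d.
Proof. by apply/funext => -[|[|[|[|?]]]]. Qed.
Lemma upd2_pt4 a b c d x : upd (pt4 a b c d) 2%N x = pt4 a b x d.
Proof. by apply/funext => -[|[|[|[|?]]]]. Qed.
Lemma upd3_pt4 a b c d x : upd (pt4 a b c d) 3%N x = pt4 a b c x.
Proof. by apply/funext => -[|[|[|[|?]]]]. Qed.
Definition upd_pt4 := (upd0_pt4, upd1_pt4, upd2_pt4, upd3_pt4).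

Lemma gdiff0_pt4 F a b c d : gdiff 0%N F (pt4 a b c d) =
  F (pt4 a.+1 b c d) + F (pt4 a.-1 b c d).
Proof. by rewrite /gdiff !upd_pt4. Qed.
Lemma gdiff1_pt4 F a b c d : gdiff 1%N F (pt4 a b c d) =
  F (pt4 a b.+1 c d) + F (pt4 a b.-1 c d).
Proof. by rewrite /gdiff !upd_pt4. Qed.
Lemma gdiff2_pt4 F a b c d : gdiff 2%N F (pt4 a b c d) =
  F (pt4 a b c.+1 d) + F (pt4 a b c.-1 d).
Proof. by rewrite /gdiff !upd_pt4. Qed.
Lemma gdiff3_pt4 F a b c d : gdiff 3%N F (pt4 a b c d) =
  F (pt4 a b c d.+1) + F (pt4 a b c d.-1).
Proof. by rewrite /gdiff !upd_pt4. Qed.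

Lemma telescope_odd m (g : nat -> 'F_2) :
  \sum_(i < m) (g (i.*2.+1).+1 + g (i.*2.+1).-1) = g m.*2 + g 0%N.
Proof.
elim: m => [|m IH]; first by rewrite big_ord0 addF2.
rewrite big_ord_recr /= {}IH doubleS.
by by rewrite -[RHS]addr0 -(addF2 (g m.*2)); ring.
Qed.

(* The gluing of the grid [[0, n]^4] whose quotient is the product of a Klein
   bottle (coordinates 0 and 1) and a torus. *)
Definition glue0 n (p : nat -> nat) := upd (upd p 0%N 0%N) 1%N (n - p 1%N)%N.

(** With constant jumps across the gluings, the coboundary of [f] descends to a cocycle of degree 1
    on the quotient; [x0], ..., [x3] are its values on the four generators given by the gluings. *)
Definition glued n (f : (nat -> nat) -> 'F_2) (x0 x1 x2 x3 : 'F_2) :=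
  forall p, in_box n p ->
    [/\ p 0%N = n -> f p = f (glue0 n p) + x0,
        p 1%N = n -> f p = f (upd p 1%N 0%N) + x1,
        p 2%N = n -> f p = f (upd p 2%N 0%N) + x2
      & p 3%N = n -> f p = f (upd p 3%N 0%N) + x3].

Section Klein.
Variable m : nat.
Let n := m.*2.
Local Notation o i := (nat_of_ord i).*2.+1.

Definition glueable f := exists x0 x1 x2 x3, glued n f x0 x1 x2 x3.

Lemma in_box_pt4 a b c d :
  (a <= n)%N -> (b <= n)%N -> (c <= n)%N -> (d <= n)%N ->
  in_box n (pt4 a b c d).
Proof. by move=> ? ? ? ? [|[|[|[|?]]]] //=; rewrite /pt4 nth_default. Qed.

Lemma glued_pt4 f x0 x1 x2 x3 a b c d : glued n f x0 x1 x2 x3 ->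
  (a <= n)%N -> (b <= n)%N -> (c <= n)%N -> (d <= n)%N ->
  [/\ f (pt4 n b c d) = f (pt4 0%N (n - b)%N c d) + x0,
      f (pt4 a n c d) = f (pt4 a 0%N c d) + x1,
      f (pt4 a b n d) = f (pt4 a b 0%N d) + x2
    & f (pt4 a b c n) = f (pt4 a b c 0%N) + x3].
Proof.
move=> gf an bn cn dn; split.
- have [+ _ _ _] := gf _ (in_box_pt4 (leqnn n) bn cn dn).
  by rewrite /glue0 !upd_pt4; apply.
- have [_ + _ _] := gf _ (in_box_pt4 an (leqnn n) cn dn).
  by rewrite !upd_pt4; apply.
- have [_ _ + _] := gf _ (in_box_pt4 an bn (leqnn n) dn).
  by rewrite !upd_pt4; apply.
- have [_ _ _ +] := gf _ (in_box_pt4 an bn cn (leqnn n)).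
  by rewrite !upd_pt4; apply.
Qed.

Lemma cup_glue_cut (s : nat) fs J p : (0 < s < 4)%N -> List.Forall glueable fs ->
  s \notin J -> interior_at n J p -> in_box n p -> p s = n ->
  cup fs J p = cup fs J (upd p s 0%N).
Proof.
move=> s4 gfs; apply: (cup_glue (rho := fun q => upd q s 0%N)).
  move=> j F q js qj; rewrite !gdiffE /=.
  rewrite ![upd (upd q j _) s _]updC //.
  by rewrite !upd_neq.
apply: List.Forall_impl gfs => f [x0 [x1 [x2 [x3 gf]]]].
case: s s4 => [//|[|[|[|//]]]] _.
- by exists x1 => q /gf[].
- by exists x2 => q /gf[].
- by exists x3 => q /gf[].
Qed.

Lemma cup_glue_flip fs J p : List.Forall glueable fs ->
  0%N \notin J -> interior_at n J p -> in_box n p -> p 0%N = n ->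
  cup fs J p = cup fs J (glue0 n p).
Proof.
move=> gfs; apply: (cup_glue (rho := glue0 n)); last first.
  apply: List.Forall_impl gfs => f [x0 [x1 [x2 [x3 gf]]]].
  by exists x0 => q /gf[].
move=> j F q j0 qj; rewrite !gdiffE /=.
have [j1|j1] := eqVneq j 1%N; last first.
  rewrite /glue0 ![upd (upd (upd q 0%N _) _ _) j _]updC 1?eq_sym //.
  rewrite ![upd (upd q 0%N _) j _]updC 1?eq_sym //.
  by rewrite !upd_neq // eq_sym.
(* Reversing coordinate 1 swaps the two ends of the cell; [qj] keeps the natural subtraction from
   truncating. *)
rewrite {}j1 in qj *; rewrite /glue0 !upd_eq !upd_upd.
rewrite ![upd (upd q 1%N _) 0%N _]updC // !upd_upd.
rewrite addrC; congr (F (upd _ _ _) + F (upd _ _ _)); lia.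
Qed.

Let odd_int i : (i < m)%N -> (0 < i.*2.+1 < n)%N.
Proof. by rewrite /n; lia. Qed.

(** Integration along a glued direction: the sum telescopes to the two ends, where the cup products
    agree by [cup_glue_cut], so only the jump of [f] survives. *)
Lemma sum_gdiff_cut1 f fs J x0 x1 x2 x3 a c d : glued n f x0 x1 x2 x3 ->
  List.Forall glueable fs -> 1%N \notin J -> interior_at n J (pt4 a n c d) ->
  (a <= n)%N -> (c <= n)%N -> (d <= n)%N ->
  \sum_(i < m) gdiff 1%N (fun q => f q * cup fs J q) (pt4 a (o i) c d) =
  x1 * cup fs J (pt4 a 0%N c d).
Proof.
move=> gf gfs J1 Jint an cn dn.
under eq_bigr do rewrite gdiff1_pt4.
rewrite (telescope_odd m (fun x => f (pt4 a x c d) * cup fs J (pt4 a x c d))).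
have [_ -> _ _] := glued_pt4 gf an (leqnn n) cn dn.
rewrite (cup_glue_cut (s := 1%N)) ?upd_pt4 //; last by apply: in_box_pt4.
by rewrite mulrDl addrAC addF2 add0r.
Qed.

Lemma sum_gdiff_cut2 f fs J x0 x1 x2 x3 a b d : glued n f x0 x1 x2 x3 ->
  List.Forall glueable fs -> 2%N \notin J -> interior_at n J (pt4 a b n d) ->
  (a <= n)%N -> (b <= n)%N -> (d <= n)%N ->
  \sum_(i < m) gdiff 2%N (fun q => f q * cup fs J q) (pt4 a b (o i) d) =
  x2 * cup fs J (pt4 a b 0%N d).
Proof.
move=> gf gfs J1 Jint an bn dn.
under eq_bigr do rewrite gdiff2_pt4.
rewrite (telescope_odd m (fun x => f (pt4 a b x d) * cup fs J (pt4 a b x d))).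
have [_ _ -> _] := glued_pt4 gf an bn (leqnn n) dn.
rewrite (cup_glue_cut (s := 2%N)) ?upd_pt4 //; last by apply: in_box_pt4.
by rewrite mulrDl addrAC addF2 add0r.
Qed.

Lemma sum_gdiff_cut3 f fs J x0 x1 x2 x3 a b c : glued n f x0 x1 x2 x3 ->
  List.Forall glueable fs -> 3%N \notin J -> interior_at n J (pt4 a b c n) ->
  (a <= n)%N -> (b <= n)%N -> (c <= n)%N ->
  \sum_(i < m) gdiff 3%N (fun q => f q * cup fs J q) (pt4 a b c (o i)) =
  x3 * cup fs J (pt4 a b c 0%N).
Proof.
move=> gf gfs J1 Jint an bn cn.
under eq_bigr do rewrite gdiff3_pt4.
rewrite (telescope_odd m (fun x => f (pt4 a b c x) * cup fs J (pt4 a b c x))).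
have [_ _ _ ->] := glued_pt4 gf an bn cn (leqnn n).
rewrite (cup_glue_cut (s := 3%N)) ?upd_pt4 //; last by apply: in_box_pt4.
by rewrite mulrDl addrAC addF2 add0r.
Qed.

(** The two ends match only after coordinate 1 is reversed, so the sum must run over that coordinate
    as well. *)
Lemma sum_gdiff_flip f fs J x0 x1 x2 x3 c d : glued n f x0 x1 x2 x3 ->
  List.Forall glueable fs -> 0%N \notin J ->
  (forall b, (0 < b < n)%N -> interior_at n J (pt4 n b c d)) ->
  (c <= n)%N -> (d <= n)%N ->
  \sum_(j < m) \sum_(i < m)
    gdiff 0%N (fun q => f q * cup fs J q) (pt4 (o i) (o j) c d) =
  x0 * \sum_(j < m) cup fs J (pt4 0%N (o j) c d).
Proof.
move=> gf gfs J1 Jint cn dn; pose g q := f q * cup fs J q.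
transitivity (\sum_(j < m) (g (pt4 n (o j) c d) + g (pt4 0%N (o j) c d))).
  apply: eq_bigr => j _.
  under eq_bigr do rewrite gdiff0_pt4.
  exact: (telescope_odd m (fun x => g (pt4 x (o j) c d))).
(* Only the sum over the end at [n] is reindexed; reversing the index of an odd coordinate reflects
   that coordinate in the grid. *)
rewrite big_split /= (reindex_inj rev_ord_inj) /= -big_split mulr_sumr.
apply: eq_bigr => j _ /=.
have oj := odd_int (ltn_ord j).
have E : (n - (m - j.+1).*2.+1 = o j)%N by move: oj; rewrite /n; lia.
have E' : (0 < (m - j.+1).*2.+1 < n)%N by move: oj; rewrite /n; lia.
have [_ E2] := andP E'; rewrite /g.
have [-> _ _ _] := glued_pt4 gf (leqnn n) (ltnW E2) cn dn.
rewrite cup_glue_flip //; last 2 first.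
- exact: Jint.
- by apply: in_box_pt4 => //; exact: ltnW.
rewrite /glue0 !upd_pt4 {}E mulrDl addrAC.
by rewrite /= addF2 add0r.
Qed.

Lemma cup_dim4 f fs (p : nat -> nat) : cup (f :: fs) [:: 0; 1; 2; 3]%N p =
  gdiff 0%N (fun q => f q * cup fs [:: 1; 2; 3]%N q) p +
  gdiff 1%N (fun q => f q * cup fs [:: 0; 2; 3]%N q) p +
  gdiff 2%N (fun q => f q * cup fs [:: 0; 1; 3]%N q) p +
  gdiff 3%N (fun q => f q * cup fs [:: 0; 1; 2]%N q) p.
Proof. by rewrite cup_cons !big_cons big_nil addr0 !addrA. Qed.

Lemma cup_dim3 f fs (p : nat -> nat) : cup (f :: fs) [:: 0; 1; 2]%N p =
  gdiff 0%N (fun q => f q * cup fs [:: 1; 2]%N q) p +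
  gdiff 1%N (fun q => f q * cup fs [:: 0; 2]%N q) p +
  gdiff 2%N (fun q => f q * cup fs [:: 0; 1]%N q) p.
Proof. by rewrite cup_cons !big_cons big_nil addr0 !addrA. Qed.

Lemma cup_dim2 f fs (j k : nat) p : j != k -> cup (f :: fs) [:: j; k] p =
  gdiff j (fun q => f q * cup fs [:: k] q) p +
  gdiff k (fun q => f q * cup fs [:: j] q) p.
Proof.
move=> jk; rewrite cup_cons !big_cons big_nil addr0 /= !eqxx /=.
by rewrite [k == j]eq_sym (negbTE jk).
Qed.

Lemma cup_dim1 f fs (j : nat) p :
  cup (f :: fs) [:: j] p = gdiff j (fun q => f q * cup fs [::] q) p.
Proof. by rewrite cup_cons big_cons big_nil addr0 /= eqxx. Qed.

Lemma glued_glueable f x0 x1 x2 x3 : glued n f x0 x1 x2 x3 -> glueable f.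
Proof. by exists x0, x1, x2, x3. Qed.

Let odd_le (i : 'I_m) : (o i <= n)%N.
Proof. by have /andP[_ /ltnW] := odd_int (ltn_ord i). Qed.

(** In this lemma and the next two, each pair of opposite faces gets its own direction innermost,
    ready to telescope; direction 0 keeps direction 1 next to it because of the flip. *)
Lemma exchange_sum2 (X Y : 'I_m -> 'I_m -> 'F_2) :
  \sum_a \sum_b (X a b + Y a b) = \sum_b \sum_a X a b + \sum_a \sum_b Y a b.
Proof.
rewrite [X in _ = X + _]exchange_big -big_split.
by apply: eq_bigr => a _; rewrite big_split.
Qed.

Lemma exchange_sum3 (X Y Z : 'I_m -> 'I_m -> 'I_m -> 'F_2) :
  \sum_a \sum_b \sum_c (X a b c + Y a b c + Z a b c) =
  \sum_c \sum_b \sum_a X a b c + \sum_a \sum_c \sum_b Y a b c +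
  \sum_a \sum_b \sum_c Z a b c.
Proof.
have -> : \sum_c \sum_b \sum_a X a b c = \sum_a \sum_b \sum_c X a b c.
  rewrite exchange_big [RHS]exchange_big; apply: eq_bigr => b _ /=.
  exact: exchange_big.
have -> : \sum_a \sum_c \sum_b Y a b c = \sum_a \sum_b \sum_c Y a b c.
  by apply: eq_bigr => a _; exact: exchange_big.
rewrite -!big_split; apply: eq_bigr => a _ /=.
by rewrite -!big_split; apply: eq_bigr => b _ /=; rewrite -!big_split.
Qed.

Lemma exchange_sum4 (X Y Z T : 'I_m -> 'I_m -> 'I_m -> 'I_m -> 'F_2) :
  \sum_a \sum_b \sum_c \sum_d (X a b c d + Y a b c d + Z a b c d + T a b c d) =
  \sum_c \sum_d \sum_b \sum_a X a b c d + \sum_a \sum_c \sum_d \sum_b Y a b c d +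
  \sum_a \sum_b \sum_d \sum_c Z a b c d +
  \sum_a \sum_b \sum_c \sum_d T a b c d.
Proof.
have -> : \sum_c \sum_d \sum_b \sum_a X a b c d =
    \sum_a \sum_b \sum_c \sum_d X a b c d.
  rewrite pair_bigA /= exchange_big /= [RHS]exchange_big; apply: eq_bigr => b _.
  by rewrite exchange_big; apply: eq_bigr => a _; rewrite pair_bigA.
have -> : \sum_a \sum_c \sum_d \sum_b Y a b c d =
    \sum_a \sum_b \sum_c \sum_d Y a b c d.
  apply: eq_bigr => a _; rewrite pair_bigA exchange_big.
  by apply: eq_bigr => b _; rewrite pair_bigA.
have -> : \sum_a \sum_b \sum_d \sum_c Z a b c d =
    \sum_a \sum_b \sum_c \sum_d Z a b c d.
  by do 2 (apply: eq_bigr => ? _); exact: exchange_big.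
rewrite -!big_split; apply: eq_bigr => a _ /=.
rewrite -!big_split; apply: eq_bigr => b _ /=.
by rewrite -!big_split; apply: eq_bigr => c _ /=; rewrite -!big_split.
Qed.

Ltac interior := let k := fresh in
  move=> k; rewrite !inE; repeat (move=> /orP[]; first by move=> /eqP->;
    rewrite /pt4 /=; first [apply: odd_int; apply: ltn_ord | assumption]);
  move=> /eqP->; rewrite /pt4 /=; first [apply: odd_int; apply: ltn_ord | assumption].

(** The factors are integrated in turn, and a term survives only in a direction where its factor
    jumps: direction 3 for [f4], directions 0 and 2 for [f3]. Of the last two, direction 2 leaves
    the square of the fibre class on the Klein bottle ([st]), direction 0 leaves it on a torus
    ([tu]). *)
Lemma cup_klein_torus f1 f2 f3 f4 :
  glued n f1 1 1 0 0 -> glued n f2 1 1 0 0 -> glued n f3 1 0 1 0 ->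
  glued n f4 0 0 0 1 ->
  \sum_(a < m) \sum_(b < m) \sum_(c < m) \sum_(d < m)
    cup [:: f4; f3; f2; f1] [:: 0; 1; 2; 3]%N (pt4 (o a) (o b) (o c) (o d)) = 1.
Proof.
move=> g1 g2 g3 g4.
have F0 : List.Forall glueable [::] by [].
have F1 : List.Forall glueable [:: f1].
  by constructor => //; exact: glued_glueable g1.
have F2 : List.Forall glueable [:: f2; f1].
  by constructor => //; exact: glued_glueable g2.
have F3 : List.Forall glueable [:: f3; f2; f1].
  by constructor => //; exact: glued_glueable g3.
(* Direction 0 gives the product of the jumps of [f2] and [f1], that is 1. Direction 1 gives the
   change of [f1] along the base from the corner (0, 0) to (n, 0); the latter is glued to (0, n),
   hence to (0, 0), and the two jumps cancel. *)
have st : \sum_(a < m) \sum_(b < m)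
    cup [:: f2; f1] [:: 0; 1]%N (pt4 (o a) (o b) 0%N 0%N) = 1.
  under eq_bigr do under eq_bigr do rewrite cup_dim2 //.
  rewrite exchange_sum2 (sum_gdiff_flip g2) //; last by move=> ? ?; interior.
  rewrite mul1r; under eq_bigr do rewrite cup_dim1.
  rewrite (sum_gdiff_cut1 g1) // [cup _ _ _]/cup mulr1 -[RHS]addr0; congr (_ + _).
  rewrite (eq_bigr (fun a : 'I_m => gdiff 0%N f1 (pt4 (o a) 0%N 0%N 0%N))).
    under eq_bigr do rewrite gdiff0_pt4.
    rewrite (telescope_odd m (fun x => f1 (pt4 x 0%N 0%N 0%N))).
    have [-> _ _ _] := glued_pt4 g1 (leq0n n) (leq0n n) (leq0n n) (leq0n n).
    have := glued_pt4 g1 (leq0n n) (leq0n n) (leq0n n) (leq0n n).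
    rewrite subn0 => -[_ -> _ _].
    by rewrite -[X in X + _]addrA addF2 addr0 addF2.
  move=> a _; rewrite (sum_gdiff_cut1 g2) //; last by interior.
  by rewrite mul1r cup_dim1 !gdiff0_pt4 /cup !mulr1.
(* The fibre class has no jump in direction 2, so its square vanishes here. *)
have tu : \sum_(b < m) \sum_(c < m)
    cup [:: f2; f1] [:: 1; 2]%N (pt4 0%N (o b) (o c) 0%N) = 0.
  under eq_bigr do under eq_bigr do rewrite cup_dim2 //.
  rewrite exchange_sum2 [X in _ + X]big1 => [|b _]; last first.
    by rewrite (sum_gdiff_cut2 g2) ?mul0r //; interior.
  rewrite addr0.
  under eq_bigr => c _ do
    [rewrite (sum_gdiff_cut1 g2) ?mul1r ?cup_dim1 //; [over|by interior]].
  by rewrite (sum_gdiff_cut2 g1) // mul0r.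
under eq_bigr do under eq_bigr do under eq_bigr do under eq_bigr do
  rewrite cup_dim4.
rewrite exchange_sum4 big1 ?add0r => [|c _]; last first.
  rewrite big1 // => d _; rewrite (sum_gdiff_flip g4) ?mul0r //.
  by move=> ? ?; interior.
rewrite big1 ?add0r => [|a _]; last first.
  do 2 (rewrite big1 // => ? _); rewrite (sum_gdiff_cut1 g4) ?mul0r //.
  by interior.
rewrite big1 ?add0r => [|a _]; last first.
  do 2 (rewrite big1 // => ? _); rewrite (sum_gdiff_cut2 g4) ?mul0r //.
  by interior.
transitivity (\sum_(a < m) \sum_(b < m) \sum_(c < m)
    cup [:: f3; f2; f1] [:: 0; 1; 2]%N (pt4 (o a) (o b) (o c) 0%N)).
  do 3 (apply: eq_bigr => ? _); rewrite (sum_gdiff_cut3 g4) ?mul1r //.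
  by interior.
under eq_bigr do under eq_bigr do under eq_bigr do rewrite cup_dim3.
rewrite exchange_sum3; transitivity (0 + 0 + 1 : 'F_2); last by rewrite !add0r.
congr (_ + _ + _).
- rewrite -[RHS]tu [RHS]exchange_big; apply: eq_bigr => c _.
  by rewrite (sum_gdiff_flip g3) ?mul1r //; move=> ? ?; interior.
- do 2 (rewrite big1 // => ? _); rewrite (sum_gdiff_cut1 g3) ?mul0r //.
  by interior.
- rewrite -[RHS]st; do 2 (apply: eq_bigr => ? _); rewrite (sum_gdiff_cut2 g3) ?mul1r //.
  by interior.
Qed.

(** As the total is 1, some cell contributes; by [cup_const] no factor is constant on it. *)
Lemma klein_torus_cell f1 f2 f3 f4 :
  glued n f1 1 1 0 0 -> glued n f2 1 1 0 0 -> glued n f3 1 0 1 0 ->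
  glued n f4 0 0 0 1 ->
  exists2 c : nat -> nat, (forall k, (k < 4)%N -> (0 < c k < n)%N) &
    forall f, List.In f [:: f4; f3; f2; f1] ->
      ~ exists x, forall q, in_cell [:: 0; 1; 2; 3]%N c q -> f q = x.
Proof.
move=> g1 g2 g3 g4; have := cup_klein_torus g1 g2 g3 g4.
apply: contraPP => noc; apply/eqP; rewrite eq_sym big1 ?oner_neq0 //.
move=> a _; rewrite big1 // => b _; rewrite big1 // => c _; rewrite big1 // => d _.
apply/eqP/contraT => /eqP W; exfalso; apply: noc.
exists (pt4 (o a) (o b) (o c) (o d)).
  by move=> [|[|[|[|//]]]] _; rewrite /pt4 /=; apply/odd_int/ltn_ord.
move=> f ff [x fx]; apply: W; apply: (cup_const (x := x)).
by apply/List.Exists_exists; exists f; split.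
Qed.

End Klein.

(** * Homotopies and motion planners *)

Lemma cvg_mx (T : Type) (F : set_system T) {FF : Filter F} (S : topologicalType)
  (a b : nat) (f : T -> 'M[S]_(a, b)) (M : 'M[S]_(a, b)) :
  (forall i j, (fun t => f t i j) @ F --> M i j) -> f @ F --> M.
Proof.
move=> fM A [P PM PA].
have : \forall t \near F, forall i j, P i j (f t i j).
  by apply: filter_forall => i; apply: filter_forall => j; exact: (fM i j _ (PM i j)).
by apply: filterS => t Pt; apply: PA.
Qed.

Lemma continuous_at_mx (X S : topologicalType) (a b : nat)
    (f : X -> 'M[S]_(a, b)) x :
  (forall i j, {for x, continuous (fun t => f t i j)}) -> {for x, continuous f}.
Proof. by move=> fx; exact: cvg_mx. Qed.

Lemma continuous_pw2 (X Y : topologicalType) (f g h : X -> Y) a :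
  {for a, continuous f} -> {for a, continuous g} -> f a = h a -> g a = h a ->
  (\forall x \near a, h x = f x \/ h x = g x) -> {for a, continuous h}.
Proof.
move=> fa ga fah gah hfg A; rewrite /= => Ah.
have /fa Af : nbhs (f a) A by rewrite fah.
have /ga Ag : nbhs (g a) A by rewrite gah.
change (\forall x \near a, A (h x)); near=> x.
have [->|->] : h x = f x \/ h x = g x by near: x.
  by near: x.
by near: x.
Unshelve. all: by end_near. Qed.

Lemma continuous_at_pair (X Y Z : topologicalType) (f : X -> Y) (g : X -> Z) x :
  {for x, continuous f} -> {for x, continuous g} ->
  {for x, continuous (fun z => (f z, g z))}.
Proof. by move=> fx gx; apply: cvg_pair. Qed.

Lemma continuous_compT (X Y Z : topologicalType) (f : X -> Y) (g : Y -> Z) :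
  continuous f -> continuous g -> continuous (g \o f).
Proof. by move=> fc gc x; apply: continuous_comp; [exact: fc|exact: gc]. Qed.

Section RealValued.
Variables (R : realType) (X : topologicalType).
Implicit Types (f g : X -> R) (x : X).

Lemma continuous_at_add f g x : {for x, continuous f} -> {for x, continuous g} ->
  {for x, continuous (fun z => f z + g z)}.
Proof. exact: cvgD. Qed.

Lemma continuous_at_sub f g x : {for x, continuous f} -> {for x, continuous g} ->
  {for x, continuous (fun z => f z - g z)}.
Proof. exact: cvgB. Qed.

Lemma continuous_at_mul f g x : {for x, continuous f} -> {for x, continuous g} ->
  {for x, continuous (fun z => f z * g z)}.
Proof. exact: cvgM. Qed.

Lemma continuous_at_sum (I : Type) (r : seq I) (f : I -> X -> R) x :
  (forall i, {for x, continuous (f i)}) ->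
  {for x, continuous (fun z => \sum_(i <- r) f i z)}.
Proof.
move=> fc; elim: r => [|i r IH].
  have -> : (fun z => \sum_(i <- [::]) f i z) = (fun=> 0).
    by apply/funext => z; rewrite big_nil.
  exact: cst_continuous.
have -> : (fun z => \sum_(j <- i :: r) f j z) =
    (fun z => f i z + \sum_(j <- r) f j z).
  by apply/funext => z; rewrite big_cons.
exact: continuous_at_add.
Qed.

Lemma continuous_at_lt f x a : {for x, continuous f} -> f x < a ->
  \forall z \near x, f z < a.
Proof. by move=> fc fa; exact: (fc _ (lt_nbhsl fa)). Qed.

Lemma continuous_at_gt f x a : {for x, continuous f} -> a < f x ->
  \forall z \near x, a < f z.
Proof. by move=> fc fa; exact: (fc _ (lt_nbhsr fa)). Qed.

End RealValued.

Lemma fst_continuous (X Y : topologicalType) : continuous (@fst X Y).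
Proof. by move=> z; exact: cvg_fst. Qed.

Lemma snd_continuous (X Y : topologicalType) : continuous (@snd X Y).
Proof. by move=> z; exact: cvg_snd. Qed.

Section UnitInterval.
Variable R : realType.
Local Notation I01 := (unit_itv R).

Lemma clamp01_subproof (t : R) : Num.max 0 (Num.min t 1) \in `[0 : R, 1]%classic.
Proof. by rewrite inE /= in_itv /= le_max lexx ge_max ler01 ge_min lexx orbT. Qed.

(** This retraction lets homotopies be written with a real time parameter. *)
Definition clamp01 (t : R) : I01 := SigSub (clamp01_subproof t).

Lemma clamp01_continuous : continuous clamp01.
Proof.
apply: continuous_comp_initial => t.
apply: (@continuous_max _ _ (fun=> 0) (fun t : R => Num.min t 1)).
  exact: cvg_cst.
by apply: (@continuous_min _ _ id (fun=> 1)); [exact: cvg_id|exact: cvg_cst].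
Qed.

Lemma unit_itv_val_continuous : continuous (set_val : I01 -> R).
Proof. exact: initial_continuous. Qed.

Lemma unit_itvP (t : I01) : 0 <= set_val t <= 1.
Proof. by have := set_valP t; rewrite /= in_itv. Qed.

Lemma clamp01K (t : I01) : clamp01 (set_val t) = t.
Proof.
apply: val_inj => /=; have /andP[t0 t1] := unit_itvP t.
by rewrite min_l // max_r.
Qed.

Lemma clamp01_le0 (t : R) : t <= 0 -> clamp01 t = itv0 R.
Proof.
move=> t0; apply: val_inj => /=.
by rewrite min_l ?max_l // (le_trans t0).
Qed.

Lemma clamp01_ge1 (t : R) : 1 <= t -> clamp01 t = itv1 R.
Proof. by move=> t0; apply: val_inj => /=; rewrite min_r ?max_r. Qed.

Lemma unit_itv_compact : compact [set: I01].
Proof.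
have -> : [set: I01] = clamp01 @` `[0 : R, 1]%classic.
  apply/seteqP; split=> // t _; exists (set_val t); last exact: clamp01K.
  exact: set_valP.
apply: continuous_compact; last exact: segment_compact.
by apply: continuous_subspaceT => t; exact: clamp01_continuous.
Qed.

Lemma unit_itv_hausdorff : hausdorff_space I01.
Proof.
move=> p q pq; apply: val_inj; apply: (@Rhausdorff R) => A B pA qB.
have [] := pq (set_val @^-1` A) (set_val @^-1` B).
- exact: unit_itv_val_continuous.
- exact: unit_itv_val_continuous.
- by move=> x [Ax Bx]; exists (set_val x).
Qed.

Lemma unit_itv_locally_compact : locally_compact [set: I01].
Proof.
move=> t _; exists setT; first exact: filterT.
by split; [exact: unit_itv_compact|exact: closedT].
Qed.

End UnitInterval.

Section Homotopy.
Variable R : realType.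
Local Notation I01 := (unit_itv R).

Definition rev01 (t : I01) : I01 := clamp01 (1 - set_val t).

Lemma rev01_continuous : continuous rev01.
Proof.
have c : continuous (fun x : R => clamp01 (1 - x)).
  move=> x; apply: (@continuous_comp _ _ _ (fun x : R => 1 - x) (@clamp01 R)).
    by apply: cvgB; [exact: cvg_cst|exact: cvg_id].
  exact: clamp01_continuous.
move=> t; apply: (@continuous_comp I01 R I01 set_val (fun x => clamp01 (1 - x)));
  last exact: c.
exact: unit_itv_val_continuous.
Qed.

Lemma homotopic_sym (X Y : topologicalType) (f g : X -> Y) :
  homotopic R f g -> homotopic R g f.
Proof.
move=> [H [Hc H0 H1]]; exists (fun z => H (z.1, rev01 z.2)); split.
- apply: (@continuous_compT _ _ _ (fun z => (z.1, rev01 z.2)) H); last exact: Hc.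
  move=> z; apply: continuous_at_pair; first exact: fst_continuous.
  exact: (continuous_compT (@snd_continuous X I01) rev01_continuous).
- by move=> x /=; rewrite /rev01 clamp01_ge1 //= subr0.
- by move=> x /=; rewrite /rev01 clamp01_le0 //= subrr.
Qed.

Lemma homotopic_comp (X Y Z : topologicalType) (f g : X -> Y) (k : Y -> Z) :
  continuous k -> homotopic R f g -> homotopic R (k \o f) (k \o g).
Proof.
move=> kc [H [Hc H0 H1]]; exists (k \o H); split.
- exact: continuous_compT Hc kc.
- by move=> x /=; rewrite H0.
- by move=> x /=; rewrite H1.
Qed.

Lemma homotopic_trans (X Y : topologicalType) (f g h : X -> Y) :
  homotopic R f g -> homotopic R g h -> homotopic R f h.
Proof.
move=> [H [Hc H0 H1]] [K [Kc K0 K1]].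
have vc : continuous (fun z : X * I01 => set_val z.2 : R).
  exact: (continuous_compT (@snd_continuous X I01) (@unit_itv_val_continuous R)).
have reparam (L : X * I01 -> Y) (r : R -> R) : continuous L -> continuous r ->
    continuous (fun z : X * I01 => L (z.1, clamp01 (r (set_val z.2)))).
  move=> Lc rc.
  apply: (@continuous_compT _ _ _ (fun z => (z.1, clamp01 (r (set_val z.2)))) L).
    move=> z; apply: continuous_at_pair; first exact: fst_continuous.
    apply: (continuous_compT _ (@clamp01_continuous R)).
    exact: (continuous_compT vc rc).
  exact: Lc.
pose r1 (t : R) := 2 * t; pose r2 (t : R) := 2 * t - 1.
have r1c : continuous r1 by move=> t; apply: cvgM; [exact: cvg_cst|exact: cvg_id].
have r2c : continuous r2 by move=> t; apply: cvgB; [exact: r1c|exact: cvg_cst].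
pose H' (z : X * I01) := H (z.1, clamp01 (r1 (set_val z.2))).
pose K' (z : X * I01) := K (z.1, clamp01 (r2 (set_val z.2))).
have H'c : continuous H' := reparam _ _ Hc r1c.
have K'c : continuous K' := reparam _ _ Kc r2c.
have v2 : continuous (fun z : X * I01 => r1 (set_val z.2)).
  exact: continuous_compT vc r1c.
exists (fun z => if r1 (set_val z.2) <= 1 then H' z else K' z); split.
- move=> z; have [z1|z1|z1] := ltgtP (r1 (set_val z.2)) 1.
  + apply: (continuous_pw2 (H'c z) (H'c z)); rewrite ?ltW //.
    near=> w; left; rewrite ltW //; near: w.
    exact: (v2 z [set y | y < 1] (lt_nbhsl z1)).
  + apply: (continuous_pw2 (K'c z) (K'c z)); rewrite ?leNgt ?z1 //.
    near=> w; left; rewrite leNgt; suff -> : 1 < r1 (set_val w.2) by [].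
    by near: w; exact: (v2 z [set y | 1 < y] (lt_nbhsr z1)).
  + apply: (continuous_pw2 (H'c z) (K'c z)); rewrite ?z1 ?lexx //.
      by rewrite /H' /K' /r2 -/(r1 _) z1 subrr (clamp01_le0 (lexx _))
        (clamp01_ge1 (lexx _)) H1 K0.
    by near=> w; case: ifP; [left|right].
- by move=> x; rewrite /= /H' /r1 /= mulr0 ler01 clamp01_le0.
- move=> x; rewrite /= /K' /r1 /r2 /= mulr1 ifN; last by rewrite -ltNge; lra.
  by rewrite clamp01_ge1 //; lra.
Unshelve. all: by end_near. Qed.

(** Running along the planner paths links their two ends, which are homotopic to the projections.
    Joint continuity in point and time is the exponential law for a locally compact Hausdorff
    interval. *)
Lemma motion_planner_homotopic (Y : topologicalType) (U : set (Y * Y)) :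
  has_motion_planner R U ->
  homotopic R (fun u : U => (set_val u).1) (fun u : U => (set_val u).2).
Proof.
move=> [s [sc sH]].
have H1 := homotopic_comp (@fst_continuous Y Y) sH.
have H2 := homotopic_comp (@snd_continuous Y Y) sH.
apply: homotopic_trans (homotopic_sym H1) _; apply: homotopic_trans H2.
exists (fun z => s z.1 z.2); split => //.
pose S u := (s u : I01 -> Y) : {compact-open, I01 -> Y}.
have -> : (fun z : U * I01 => s z.1 z.2) = uncurry S by apply/funext => -[].
apply: continuous_uncurry.
- exact: unit_itv_locally_compact.
- exact: unit_itv_hausdorff.
- apply: (@continuous_compT U (pathSpace R Y) {compact-open, I01 -> Y} s
    (fun gamma => gamma : I01 -> Y)) sc _.
  exact: initial_continuous.
- by move=> u; exact: (@cts_fun _ _ (s u)).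
Qed.

(** Trades a homotopy on the subspace [U] for a total function continuous at the points over [U], so
    that transport needs no subtypes; openness of [U] makes the two notions of continuity agree. *)
Lemma motion_planner_extend (Y : topologicalType) (U : set (Y * Y)) :
  open U -> has_motion_planner R U ->
  exists G : (Y * Y) * R -> Y,
    [/\ forall z t, U z -> {for (z, t), continuous G},
        forall z, U z -> G (z, 0) = z.1 & forall z, U z -> G (z, 1) = z.2].
Proof.
move=> oU /motion_planner_homotopic[H [Hc H0 H1]].
pose G (w : (Y * Y) * R) := if pselect (U w.1) is left Uw
  then H (SigSub (mem_set Uw), clamp01 w.2) else w.1.1.
exists G; split; last 2 first.
- by move=> z Uz; rewrite /G; case: pselect => //= ?; rewrite clamp01_le0 // H0.
- by move=> z Uz; rewrite /G; case: pselect => //= ?; rewrite clamp01_ge1 // H1.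
move=> z t Uz A; rewrite /= {1}/G /=; case: pselect => //= Uz' HA.
have [[B C] /= [[B' [[B'' oB'' <-] B'z]] B'B tC] BCA] := Hc _ _ HA.
have zB : nbhs z B'' by apply: open_nbhs_nbhs.
have tC' : nbhs t (@clamp01 R @^-1` C) by exact: clamp01_continuous.
exists (B'' `&` U, @clamp01 R @^-1` C).
  by split => //; apply: filterI => //; exact: open_nbhs_nbhs.
move=> [w u] /= [[Bw Uw] Cu]; rewrite /G /=; case: pselect => // Uw'.
by apply: (BCA (_, _)); split => //; apply: B'B.
Qed.

End Homotopy.

(** * The topology of small covers *)

Section SmallCoverTopology.
Variables (X : topologicalType) (P : set X) (I : finType) (F : I -> set X).
Variables (n : nat) (lam : charFun P F n).
Local Notation M := (smallCover lam).

Definition cover_pt (y : P) (g : 'cV['F_2]_n) : M :=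
  \pi_M%qT ((y, g) : coverBase P n).

Lemma cover_ptP y g y' g' : cover_pt y g = cover_pt y' g' <->
  y = y' /\ g' - g \in face_group lam (set_val y).
Proof.
split=> [/eqquotP/=|[<- gg']].
  by rewrite /cover_rel => /andP[/eqP /= -> ->].
by apply/eqquotP; rewrite /= /cover_rel eqxx gg'.
Qed.

Lemma cover_ptE (m : M) : exists y g, m = cover_pt y g.
Proof.
exists (repr m).1, (repr m).2; rewrite -[m in LHS]reprK /cover_pt.
by case: (repr m).
Qed.

Lemma coverBase_cvg (y : P) (g : 'cV['F_2]_n) (S : set (coverBase P n)) :
  nbhs ((y, g) : coverBase P n) S -> \forall y' \near y, S (y', g).
Proof.
move=> [[B C] /= [By Cg] BCS].
have {}Cg : C g by exact: nbhs_singleton Cg.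
by apply: filterS By => y' By'; apply: (BCS (_, _)).
Qed.

(** The labels need not converge, only stay in one coset of the face group at the limit: each of the
    finitely many labels in that coset represents the same limit point. *)
Lemma cover_pt_cvg (T : Type) (G : set_system T) {FG : Filter G}
    (y : T -> P) (g : T -> 'cV['F_2]_n) y0 g0 :
  y @ G --> y0 -> (\forall t \near G, g t - g0 \in face_group lam (set_val y0)) ->
  (fun t => cover_pt (y t) (g t)) @ G --> cover_pt y0 g0.
Proof.
move=> yy0 gg0 A; rewrite /= => Anb.
have Ah (h : 'cV['F_2]_n) : \forall y' \near y0,
    h - g0 \in face_group lam (set_val y0) -> A (cover_pt y' h).
  have [hG|hG] := boolP (h - g0 \in _); last by near=> z => //.
  have E : cover_pt y0 h = cover_pt y0 g0.
    by apply/esym/cover_ptP; split.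
  have : nbhs ((y0, h) : coverBase P n) (\pi_M%qT @^-1` A).
    have : nbhs (cover_pt y0 h) A by rewrite E.
    have := @pi_continuous _ {eq_quot (cover_equiv lam)}%qT ((y0, h) : coverBase P n).
    exact.
  by move/coverBase_cvg; apply: filterS => y' ? _.
have {}Ah := filter_forall (nbhs_filter _) Ah.
have {}Ah : \forall t \near G, forall h, h - g0 \in face_group lam (set_val y0) ->
    A (cover_pt (y t) h) by exact: (yy0 _ Ah).
by apply: filterS (filterI gg0 Ah) => t [/= tG]; apply.
Unshelve. all: by end_near. Qed.

Hypothesis F_closed : forall i, closed (F i).

Lemma near_facets_at (y0 : P) :
  \forall y \near y0, facets_at F (set_val y) \subset facets_at F (set_val y0).
Proof.
have near_i i : \forall y \near y0,
    i \in facets_at F (set_val y) -> i \in facets_at F (set_val y0).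
  have [iy0|iy0] := boolP (i \in facets_at F (set_val y0)); first by near=> z.
  have : nbhs (set_val y0) (~` F i).
    apply: open_nbhs_nbhs; split; first exact: closed_openC.
    by move: iy0; rewrite inE; apply: contraNnot => /asboolP.
  move/(@initial_continuous _ _ set_val y0) => nF.
  have {}nF : \forall y \near y0, ~ F i (set_val y) by [].
  by apply: filterS nF => y /= nFy; rewrite inE => /asboolP.
have := filter_forall (nbhs_filter _) near_i; apply: filterS => y iy.
by apply/fintype.subsetP.
Unshelve. all: by end_near. Qed.

Lemma face_group_sub (y y0 : P) :
  facets_at F (set_val y) \subset facets_at F (set_val y0) ->
  (face_group lam (set_val y) <= face_group lam (set_val y0))%VS.
Proof.
move=> /fintype.subsetP yy0; apply: sub_span => v /mapP[i].
rewrite mem_enum => /yy0 iy0 ->; apply: map_f; by rewrite mem_enum.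
Qed.

(* A fibre of the quotient map has a basis of saturated neighbourhoods. *)
Lemma near_cover_pt y0 g0 (Q : M -> Prop) :
  (forall g, g - g0 \in face_group lam (set_val y0) ->
     \forall y \near y0, Q (cover_pt y g)) ->
  \forall m \near cover_pt y0 g0, Q m.
Proof.
move=> Qg.
have : \forall y \near y0, forall g, g - g0 \in face_group lam (set_val y0) ->
    Q (cover_pt y g).
  apply: (filter_forall (F := nbhs y0)) => g.
  have [gG|gG] := boolP (g - g0 \in face_group lam (set_val y0)).
    by apply: filterS (Qg g gG) => y ? _.
  by near=> z.
move=> /(filterI (near_facets_at y0)); rewrite nbhsE => -[N [oN Ny0] NQ].
pose S : set M := [set m | exists y g,
  [/\ N y, g - g0 \in face_group lam (set_val y0) & m = cover_pt y g]].
have SE y g : S (cover_pt y g) <->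
    N y /\ g - g0 \in face_group lam (set_val y0).
  split=> [[y' [g' [Ny' gg' /cover_ptP[yy' ggy]]]]|[Ny gg0]]; last by exists y, g.
  rewrite yy'; split => //; rewrite -yy' in Ny' gg' *.
  have [/face_group_sub sub _] := NQ _ Ny'.
  have := memvB gg' (subvP sub _ ggy).
  by rewrite opprB addrAC addrCA subrr addr0 addrC.
have oS : open S.
  rewrite /open /= /quotient_open openE => -[y g] /= /SE[Ny gg0].
  have Ny' : nbhs y N by exact: open_nbhs_nbhs.
  exists (N, [set g]); first by split => //; rewrite nbhs_principalE.
  by move=> [y' g'] /= [Ny'' ->]; apply/SE.
have : nbhs (cover_pt y0 g0) S.
  by apply: open_nbhs_nbhs; split => //; apply/SE; rewrite subrr mem0v.
apply: filterS => m [y [g [Ny gg ->]]].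
by have [_] := NQ _ Ny; apply.
Unshelve. all: by end_near. Qed.

End SmallCoverTopology.

(** The only scalars are 0 and 1, so a span is exhausted by adding generators one at a time; in a
    face group, this means crossing one facet at a time. *)
Lemma span_F2_ind (V : vectType 'F_2) (r : seq V) (Q : V -> Prop) :
  Q 0 -> (forall v w, v \in r -> Q w -> Q (w + v)) ->
  forall w, w \in span r -> Q w.
Proof.
move=> Q0 QD; suff : forall u w, Q u -> w \in span r -> Q (u + w).
  by move=> H w wr; rewrite -[w]add0r; exact: H.
elim: r QD => [|v r IH] QD u w Qu.
  by rewrite span_nil memv0 => /eqP->; rewrite addr0.
rewrite span_cons => /memv_addP[_ /vlineP[k ->] [w' ws ->]].
rewrite addrA; apply: IH ws => [v' w'' v'r|]; first by apply: QD; rewrite inE v'r orbT.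
have [->|->] : k = 0 \/ k = 1; last 2 first.
- by rewrite scale0r addr0.
- by rewrite scale1r; apply: QD => //; exact: mem_head.
by case: k => [[|[|?]]] // ?; [left|right]; apply/eqP.
Qed.

(** * Real Bott manifolds in cube coordinates *)

Section RealBottTopology.
Variables (R : realType) (n : nat) (A : bottMatrix n).
Local Notation M := (realBott R A).
Local Notation lam := (CharFun (@bott_char_characteristic R n A)).

Lemma cube_clamp_subproof (x : 'rV[R]_n) :
  \row_j Num.max 0 (Num.min (x 0 j) 1) \in @cube R n.
Proof.
by rewrite inE /cube /= => j; rewrite mxE le_max lexx ge_max ler01 ge_min lexx orbT.
Qed.

Definition cube_clamp (x : 'rV[R]_n) : @cube R n := SigSub (cube_clamp_subproof x).

Lemma cube_clampK x : cube x -> set_val (cube_clamp x) = x.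
Proof.
move=> cx; apply/rowP => j /=; rewrite mxE; have /andP[x0 x1] := cx j.
by rewrite min_l // max_r.
Qed.

Lemma cube_clamp_val (y : @cube R n) : cube_clamp (set_val y) = y.
Proof. by apply: val_inj; apply: cube_clampK; exact: set_valP. Qed.

Lemma cube_clamp_continuous : continuous cube_clamp.
Proof.
apply: continuous_comp_initial => x; apply: continuous_at_mx => i j /=.
have -> : (fun t => set_val (cube_clamp t) i j) =
    (fun t : 'rV[R]_n => Num.max 0 (Num.min (t 0 j) 1)).
  by apply/funext => t; rewrite mxE.
apply: (@continuous_max _ _ (fun=> 0) (fun x : 'rV[R]_n => Num.min (x 0 j) 1)).
  exact: cst_continuous.
apply: (@continuous_min _ _ (fun x : 'rV[R]_n => x 0 j) (fun=> 1)).
  exact: coord_continuous.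
exact: cst_continuous.
Qed.

Lemma cube_facet_closed (i : 'I_n * bool) : closed (@cube_facet R n i).
Proof.
have -> : @cube_facet R n i = 
    (fun x : 'rV[R]_n => x 0 i.1) @^-1` [set i.2%:R] `&`
    \bigcap_(j in [set: 'I_n]) ((fun x : 'rV[R]_n => x 0 j) @^-1` `[0, 1]).
  apply/seteqP; split=> [x [cx xi]|x [xi cx]]; split => //.
    by move=> j _ /=; rewrite in_itv; exact: cx.
  by move=> j; have := cx j I; rewrite /= in_itv.
apply: closedI.
  apply: preimage_closed; last exact: closed_eq.
  by move=> x _; exact: coord_continuous.
apply: closed_bigI => j _; apply: preimage_closed; last exact: itv_closed.
by move=> x _; exact: coord_continuous.
Qed.

(** Clamping makes this total, so straight paths can be parametrised by all reals even where they
    leave the cube. *)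
Definition bott_pt (x : 'rV[R]_n) (g : 'cV['F_2]_n) : M :=
  cover_pt lam (cube_clamp x) g.

Definition bott_grp (x : 'rV[R]_n) : {vspace 'cV['F_2]_n} :=
  face_group lam (set_val (cube_clamp x)).

Lemma bott_grp_facet x j (b : bool) : set_val (cube_clamp x) 0 j = b%:R ->
  bott_char A (j, b) \in bott_grp x.
Proof.
move=> xj; apply/memv_span/map_f; rewrite mem_enum inE; apply/asboolP.
by split => //; exact: set_valP.
Qed.

Lemma bott_grp_ind x (Q : 'cV['F_2]_n -> Prop) : Q 0 ->
  (forall j (b : bool) g, set_val (cube_clamp x) 0 j = b%:R -> Q g ->
     Q (g + bott_char A (j, b))) ->
  forall g, g \in bott_grp x -> Q g.
Proof.
move=> Q0 QD; apply: span_F2_ind => // v w /mapP[[j b]].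
by rewrite mem_enum inE => /asboolP[_ /= xj] ->; exact: QD.
Qed.

Lemma bott_grpS x y :
  (forall j (b : bool), set_val (cube_clamp x) 0 j = b%:R ->
     set_val (cube_clamp y) 0 j = b%:R) ->
  (bott_grp x <= bott_grp y)%VS.
Proof.
move=> xy; apply/subvP; apply: bott_grp_ind; first exact: mem0v.
by move=> j b g /xy xj gy; apply: memvD => //; exact: bott_grp_facet.
Qed.

Lemma bott_pt_eq x g g' : g' - g \in bott_grp x -> bott_pt x g = bott_pt x g'.
Proof. by move=> gg'; apply/cover_ptP. Qed.

Lemma bott_pt_inj x g x' g' : cube x -> cube x' ->
  bott_pt x g = bott_pt x' g' -> x = x' /\ g' - g \in bott_grp x.
Proof.
by move=> cx cx' /cover_ptP[/(congr1 set_val) + ?]; rewrite !cube_clampK.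
Qed.

Lemma bott_ptE (m : M) : exists x g, cube x /\ m = bott_pt x g.
Proof.
have [y [g ->]] := cover_ptE m; exists (set_val y), g; split.
  exact: set_valP.
by rewrite /bott_pt cube_clamp_val.
Qed.

Lemma bott_pt_cvg (T : Type) (G : set_system T) {FG : Filter G}
    (x : T -> 'rV[R]_n) (g : T -> 'cV['F_2]_n) x0 g0 :
  x @ G --> x0 -> (\forall t \near G, g t - g0 \in bott_grp x0) ->
  (fun t => bott_pt (x t) (g t)) @ G --> bott_pt x0 g0.
Proof.
move=> xx0; apply: cover_pt_cvg.
exact: cvg_comp xx0 (@cube_clamp_continuous x0).
Qed.

Lemma near_bott_pt x0 g0 (Q : M -> Prop) : cube x0 ->
  (forall g, g - g0 \in bott_grp x0 ->
     \forall x \near x0, cube x -> Q (bott_pt x g)) ->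
  \forall m \near bott_pt x0 g0, Q m.
Proof.
move=> cx0 Qg; apply: near_cover_pt; first exact: cube_facet_closed.
move=> g gg0.
have v0 : set_val (cube_clamp x0) = x0 by exact: cube_clampK.
have := Qg g gg0; rewrite -{1}v0 => /(@initial_continuous _ _ set_val _) H.
have {}H : \forall y \near cube_clamp x0,
   cube (set_val y) -> Q (bott_pt (set_val y) g) by [].
apply: filterS H => y; rewrite /bott_pt cube_clamp_val; apply.
exact: set_valP.
Qed.

End RealBottTopology.

(** * The upper bound *)

Lemma homotopic_restrict (R : realType) (Z Y : topologicalType) (U : set Z)
    (G : Z * R -> Y) : (forall z t, U z -> {for (z, t), continuous G}) ->
  homotopic R (fun u : U => G (set_val u, 0)) (fun u : U => G (set_val u, 1)).
Proof.
move=> Gc; exists (fun w => G (set_val w.1, set_val w.2)); split => // w.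
apply: (@continuous_comp _ _ _ (fun w => (set_val w.1, set_val w.2)) G).
  apply: continuous_at_pair.
    exact: (continuous_compT (@fst_continuous U (unit_itv R))
      (@initial_continuous _ _ set_val)).
  exact: (continuous_compT (@snd_continuous U (unit_itv R))
    (@unit_itv_val_continuous R)).
by apply: Gc; exact: set_valP.
Qed.

(** The constant path at [y] serves everywhere, since a planner is a section only up to homotopy. *)
Lemma motion_planner_null (R : realType) (Y : topologicalType) (U : set (Y * Y))
    (y : Y) : homotopic R (fun _ : U => (y, y)) (@set_val _ U) ->
  has_motion_planner R U.
Proof.
have cy : continuous (fun _ : unit_itv R => y) by exact: cst_continuous.
pose B := isContinuous.Build (unit_itv R) Y (fun _ => y) cy.
pose c : continuousType (unit_itv R) Y := HB.pack (fun _ : unit_itv R => y) B.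
move=> H; exists (fun _ => (c : pathSpace R Y)); split => //.
exact: cst_continuous.
Qed.

Section Upper.
Variables (R : realType) (n : nat) (A : bottMatrix n).
Local Notation M := (realBott R A).
Local Notation pt := (@bott_pt R n A).

Definition bott_coord (m : M) : 'rV[R]_n := set_val (repr m).1.
(** Depends on the chosen representative; by [bott_labelK] it is determined modulo [bott_grp]. *)
Definition bott_label (m : M) : 'cV['F_2]_n := (repr m).2.

Lemma bott_coord_cube m : cube (bott_coord m).
Proof. exact: set_valP. Qed.

Lemma bott_ptK m : pt (bott_coord m) (bott_label m) = m.
Proof.
rewrite /bott_pt cube_clamp_val -[RHS]reprK /cover_pt /bott_label.
by case: (repr m).
Qed.

Lemma bott_coordK x g : cube x -> bott_coord (pt x g) = x.
Proof.
by move=> cx; have [] := bott_pt_inj (bott_coord_cube _) cx (bott_ptK (pt x g)).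
Qed.

Lemma bott_labelK x g : cube x -> bott_label (pt x g) - g \in bott_grp A x.
Proof.
move=> cx; have [] := bott_pt_inj (bott_coord_cube _) cx (bott_ptK (pt x g)).
by rewrite bott_coordK // => _; rewrite -memvN opprB.
Qed.

Lemma bott_coord_continuous : continuous bott_coord.
Proof.
move=> m S; have [x0 [g0 [cx0 ->]]] := bott_ptE m.
rewrite /= bott_coordK // => Sm; apply: near_bott_pt => //.
by move=> g _; apply: filterS Sm => x Sx cx; rewrite /= bott_coordK.
Qed.

(** A quotient map times an identity need not be a quotient map; here the labels are finite in
    number, so one neighbourhood of [t0] serves them all. *)
Lemma near_bott_pt2 (T : topologicalType) x0 g0 (t0 : T) (Q : M * T -> Prop) :
  cube x0 ->
  (forall g, g - g0 \in bott_grp A x0 ->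
     \forall w \near (x0, t0), cube w.1 -> Q (pt w.1 g, w.2)) ->
  \forall w \near (pt x0 g0, t0), Q w.
Proof.
move=> cx0 Qg.
have /choice[B BP] : forall g, exists B : set T, nbhs t0 B /\
    (g - g0 \in bott_grp A x0 -> \forall x \near x0, cube x ->
       forall t, B t -> Q (pt x g, t)).
  move=> g; have [gG|gG] := boolP (g - g0 \in bott_grp A x0).
    have [[S B] /= [Sx Bt] SB] := Qg g gG; exists B; split => // _.
    by apply: filterS Sx => x Sx cx t Bt'; exact: (SB (x, t)).
  by exists setT; split => //; exact: filterT.
have Bt : \forall t \near t0, forall g, B g t.
  by apply: filter_forall => g; have [] := BP g.
exists ([set m | forall t, (forall g, B g t) -> Q (m, t)],
        [set t | forall g, B g t]).
  split => //=; apply: near_bott_pt => // g gG; have [_ /(_ gG)] := BP g.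
  by apply: filterS => x xQ cx t Bt'; exact: xQ.
by move=> [m t] [/= mQ tB]; exact: mQ.
Qed.

Variable J : {set 'I_n}.

Definition edge_dist (m : M) j : R :=
  Num.min (bott_coord m 0 j) (1 - bott_coord m 0 j).

Definition cell_dom (m : M) :=
  (forall j, j \in J -> edge_dist m j < 1/2) /\
  (forall j, j \notin J -> 0 < edge_dist m j).

Definition cell_center (x : 'rV[R]_n) : 'rV[R]_n :=
  \row_j if j \in J then (1/2 < x 0 j)%R%:R else 1/2.

Definition cell_seg (x : 'rV[R]_n) (t : R) :=
  (1 - t) *: x + t *: cell_center x.

Definition cell_hom (w : M * R) : M :=
  pt (cell_seg (bott_coord w.1) w.2) (bott_label w.1).

Lemma edge_dist_continuous j : continuous (edge_dist^~ j).
Proof.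
move=> m; apply: (@continuous_comp _ _ _ bott_coord
  (fun x : 'rV[R]_n => Num.min (x 0 j) (1 - x 0 j))).
  exact: bott_coord_continuous.
apply: (@continuous_min _ _ (fun x : 'rV[R]_n => x 0 j) (fun x => 1 - x 0 j)).
  exact: coord_continuous.
by apply: continuous_at_sub; [exact: cst_continuous|exact: coord_continuous].
Qed.

Lemma edge_dist_ge0 m j : 0 <= edge_dist m j.
Proof.
have /andP[x0 x1] := bott_coord_cube m j.
by rewrite le_min x0 subr_ge0.
Qed.

Lemma near_cell_dom m0 : cell_dom m0 -> \forall m \near m0, cell_dom m.
Proof.
move=> [J1 J2].
have H1 : \forall m \near m0, forall j, j \in J -> edge_dist m j < 1/2.
  apply: (filter_forall (F := nbhs m0)) => j.
  have [jJ|jJ] := boolP (j \in J); last by near=> m.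
  have := continuous_at_lt (@edge_dist_continuous j m0) (J1 j jJ).
  by apply: filterS => m ? _.
have H2 : \forall m \near m0, forall j, j \notin J -> 0 < edge_dist m j.
  apply: (filter_forall (F := nbhs m0)) => j.
  have [jJ|jJ] := boolP (j \in J); first by near=> m.
  have := continuous_at_gt (@edge_dist_continuous j m0) (J2 j jJ).
  by apply: filterS => m ? _.
by apply: filterS (filterI H1 H2) => m [].
Unshelve. all: by end_near. Qed.

(** On a facet the edge distance in its direction is 0, so this direction is in [J] and is pushed to
    the end where it already is. Hence the push respects the identifications. *)
Lemma cell_seg_facet x g t : cube x -> cell_dom (pt x g) ->
  (bott_grp A x <= bott_grp A (cell_seg x t))%VS.
Proof.
move=> cx [J1 J2]; apply: bott_grpS => j b.
rewrite cube_clampK // => xj; rewrite mxE.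
suff -> : cell_seg x t 0 j = b%:R.
  case: b {xj}; rewrite ?mulr1n ?mulr0n; first by rewrite minxx max_r ?ler01.
  by rewrite min_l ?ler01 // maxxx.
have jJ : j \in J.
  apply: contraT => /J2; rewrite /edge_dist bott_coordK // xj lt_min.
  by case: b {xj}; rewrite ?subrr ltxx ?andbF.
rewrite !mxE jJ xj; case: b {xj} => /=.
  have -> : 1/2 < 1 :> R by lra.
  by rewrite mulr1n !mulr1 subrK.
have -> : (1/2 < 0 :> R) = false by apply/negP; lra.
by rewrite mulr0n !mulr0 addr0.
Qed.

Lemma cell_hom_pt x g t : cube x -> cell_dom (pt x g) ->
  cell_hom (pt x g, t) = pt (cell_seg x t) g.
Proof.
move=> cx xJ; rewrite /cell_hom /= bott_coordK //; apply/esym/bott_pt_eq.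
by apply: (subvP (cell_seg_facet t cx xJ)); exact: bott_labelK.
Qed.

Lemma cell_hom0 m : cell_hom (m, 0) = m.
Proof.
by rewrite /cell_hom /cell_seg /= subr0 scale1r scale0r addr0 bott_ptK.
Qed.

Lemma near_cell_center x0 g0 : cube x0 -> cell_dom (pt x0 g0) ->
  \forall x \near x0, cell_center x = cell_center x0.
Proof.
move=> cx0 [J1 _].
suff : \forall x \near x0, forall j, j \in J ->
    (1/2 < (x : 'rV[R]_n) 0 j) = (1/2 < x0 0 j).
  apply: filterS => x xJ; apply/rowP => j; rewrite !mxE.
  by case: ifP => // /xJ ->.
apply: (filter_forall (F := nbhs x0)) => j.
have [jJ|jJ] := boolP (j \in J); last by near=> x.
have := J1 j jJ; rewrite /edge_dist bott_coordK // gt_min => /orP[x0j|x0j].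
  have := continuous_at_lt (@coord_continuous R 1 n 0 j x0) x0j.
  by apply: filterS => x /= xj _; rewrite !ltNge !ltW.
have x0j' : 1/2 < x0 0 j by lra.
have := continuous_at_gt (@coord_continuous R 1 n 0 j x0) x0j'.
by apply: filterS => x /= xj _; rewrite xj x0j'.
Unshelve. all: by end_near. Qed.

Lemma bott_pt_continuous g : continuous (fun x => pt x g).
Proof.
move=> x; apply: (@bott_pt_cvg R n A _ (nbhs x) _ id (fun=> g)); first exact: cvg_id.
by apply: nearW => y; rewrite subrr mem0v.
Qed.

Lemma cell_seg_continuous x0 g0 t0 : cube x0 -> cell_dom (pt x0 g0) ->
  {for (x0, t0), continuous (fun w : 'rV[R]_n * R => cell_seg w.1 w.2)}.
Proof.
move=> cx0 xJ; pose f (w : 'rV[R]_n * R) := (1 - w.2) *: w.1 + w.2 *: cell_center x0.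
have fc : {for (x0, t0), continuous f}.
  apply: continuous_at_mx => i j; rewrite ord1.
  have -> : (fun w => f w 0 j) =
      (fun w => (1 - w.2) * w.1 0 j + w.2 * cell_center x0 0 j).
    by apply/funext => w; rewrite !mxE.
  apply: continuous_at_add.
    apply: continuous_at_mul.
      apply: continuous_at_sub; first exact: cst_continuous.
      exact: snd_continuous.
    apply: (continuous_compT (@fst_continuous _ R) (@coord_continuous R 1 n 0 j)).
  apply: continuous_at_mul; last exact: cst_continuous.
  exact: snd_continuous.
apply: (continuous_pw2 fc fc) => //.
have H : \forall w \near (x0, t0), cell_center w.1 = cell_center x0.
  exact: (@fst_continuous _ R (x0, t0) _ (near_cell_center cx0 xJ)).
by apply: filterS H => w wc; left; rewrite /cell_seg wc.
Qed.

Lemma cell_hom_continuous m0 t0 : cell_dom m0 ->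
  {for (m0, t0), continuous cell_hom}.
Proof.
have [x0 [g0 [cx0 ->]]] := bott_ptE m0 => xJ S.
rewrite /= cell_hom_pt // => nS.
apply: near_bott_pt2 => // g gG.
have Eg : pt x0 g = pt x0 g0 by apply/esym/bott_pt_eq.
have xJg : cell_dom (pt x0 g) by rewrite Eg.
have H1 : \forall x \near x0, cell_dom (pt x g).
  by apply: (@bott_pt_continuous g x0); exact: near_cell_dom.
have {}H1 : \forall w \near (x0, t0), cell_dom (pt w.1 g).
  exact: (@fst_continuous _ R (x0, t0) _ H1).
have H2 : \forall w \near (x0, t0), S (pt (cell_seg w.1 w.2) g).
  apply: (@continuous_comp _ _ _ (fun w : 'rV[R]_n * R => cell_seg w.1 w.2)
    (fun x => pt x g) (x0, t0)).
  - exact: cell_seg_continuous xJ.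
  - exact: bott_pt_continuous.
  - rewrite /=; suff <- : pt (cell_seg x0 t0) g0 = pt (cell_seg x0 t0) g by [].
    by apply: bott_pt_eq; exact: (subvP (cell_seg_facet t0 cx0 xJ)).
by apply: filterS (filterI H1 H2) => -[x t] /= [xJ' xS] cx; rewrite cell_hom_pt.
Qed.

(** The end of the push depends only on discrete data, the nearest ends and the label up to
    identification. *)
Lemma near_cell_hom1 m0 : cell_dom m0 ->
  \forall m \near m0, cell_hom (m, 1) = cell_hom (m0, 1).
Proof.
have [x0 [g0 [cx0 ->]]] := bott_ptE m0 => xJ.
apply: near_bott_pt => // g gG.
have Eg : pt x0 g = pt x0 g0 by apply/esym/bott_pt_eq.
have xJg : cell_dom (pt x0 g) by rewrite Eg.
have H1 : \forall x \near x0, cell_dom (pt x g).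
  by apply: (@bott_pt_continuous g x0); exact: near_cell_dom.
apply: filterS (filterI H1 (near_cell_center cx0 xJ)) => x /= [xJ' xc] cx.
by rewrite -Eg !cell_hom_pt // /cell_seg subrr !scale0r !add0r xc.
Qed.

End Upper.

(** * Motion planners on 2n + 1 open sets *)

Section UpperBound.
Variables (R : realType) (n : nat) (A : bottMatrix n).
Local Notation M := (realBott R A).
Local Notation pt := (@bott_pt R n A).

Definition bott_vertex : M := pt (const_mx 1) 0.

(** Built from a chosen representative, so it need not be continuous in [m]; it is applied only to
    locally constant maps. *)
Definition vertex_path (m : M) (t : R) : M :=
  pt ((1 - t) *: bott_coord m + t *: const_mx 1) (bott_label m).

Lemma vertex_path0 m : vertex_path m 0 = m.
Proof. by rewrite /vertex_path subr0 scale1r scale0r addr0 bott_ptK. Qed.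

(** All facets F_1^j meet at this vertex and their vectors e_j span everything, so all copies of the
    cube share it. *)
Lemma bott_pt_vertex g : pt (const_mx 1) g = bott_vertex.
Proof.
apply/esym/bott_pt_eq; rewrite subr0 [g]matrix_sum_delta.
apply: memv_suml => j _; apply: memv_suml => k _; rewrite ord1; apply: memvZ.
apply: (@bott_grp_facet _ _ A _ j true).
by rewrite !mxE minxx max_r ?ler01.
Qed.

Lemma vertex_path1 m : vertex_path m 1 = bott_vertex.
Proof. by rewrite /vertex_path subrr scale0r scale1r add0r bott_pt_vertex. Qed.

Lemma vertex_path_continuous m : continuous (vertex_path m).
Proof.
move=> t; apply: (@continuous_comp _ _ _ (fun t : R =>
  (1 - t) *: bott_coord m + t *: const_mx 1) (fun x => pt x (bott_label m))).
  apply: continuous_at_mx => i j; rewrite ord1.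
  have -> : (fun t => ((1 - t) *: bott_coord m + t *: const_mx 1) 0 j) =
      (fun t => (1 - t) * bott_coord m 0 j + t).
    by apply/funext => u; rewrite !mxE mulr1.
  apply: continuous_at_add; last exact: cvg_id.
  apply: continuous_at_mul; last exact: cst_continuous.
  by apply: continuous_at_sub; [exact: cst_continuous|exact: cvg_id].
exact: bott_pt_continuous.
Qed.

Local Notation D := ('I_n + 'I_n)%type.

Definition edge_dist2 (c : D) (z : M * M) : R :=
  match c with inl j => edge_dist z.1 j | inr j => edge_dist z.2 j end.

Lemma edge_dist2_continuous c : continuous (edge_dist2 c).
Proof.
case: c => j.
  exact: (continuous_compT (@fst_continuous M M) (@edge_dist_continuous _ _ A j)).
exact: (continuous_compT (@snd_continuous M M) (@edge_dist_continuous _ _ A j)).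
Qed.

(* The points where the coordinates in [J] are strictly closer to an end of
   [[0, 1]] than the others; for [#|J|] fixed, these sets are disjoint. *)
Definition open_cell (J : {set D}) : set (M * M) := [set z |
  (forall c, c \in J -> edge_dist2 c z < 1/2) /\
  (forall c, c \notin J -> 0 < edge_dist2 c z) /\
  (forall c c', c \in J -> c' \notin J -> edge_dist2 c z < edge_dist2 c' z)].

Lemma open_cell_open J : open (open_cell J).
Proof.
rewrite openE => z0 [J1 [J2 J3]].
have H1 : \forall z \near z0, forall c, c \in J -> edge_dist2 c z < 1/2.
  apply: (filter_forall (F := nbhs z0)) => c.
  have [cJ|cJ] := boolP (c \in J); last by near=> z.
  by apply: filterS (continuous_at_lt (@edge_dist2_continuous c z0) (J1 c cJ)).
have H2 : \forall z \near z0, forall c, c \notin J -> 0 < edge_dist2 c z.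
  apply: (filter_forall (F := nbhs z0)) => c.
  have [cJ|cJ] := boolP (c \in J); first by near=> z.
  by apply: filterS (continuous_at_gt (@edge_dist2_continuous c z0) (J2 c cJ)).
have H3 : \forall z \near z0, forall c c', c \in J -> c' \notin J ->
    edge_dist2 c z < edge_dist2 c' z.
  apply: (filter_forall (F := nbhs z0)) => c.
  apply: (filter_forall (F := nbhs z0)) => c'.
  have [cJ|cJ] := boolP (c \in J); last by near=> z.
  have [cJ'|cJ'] := boolP (c' \in J); first by near=> z.
  have dc : {for z0, continuous (fun z => edge_dist2 c' z - edge_dist2 c z)}.
    by apply: continuous_at_sub; exact: edge_dist2_continuous.
  have d0 : 0 < edge_dist2 c' z0 - edge_dist2 c z0 by rewrite subr_gt0 J3.
  by apply: filterS (continuous_at_gt dc d0) => z + _ _; rewrite subr_gt0.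
by apply: filterS (filterI H1 (filterI H2 H3)) => z [? []].
Unshelve. all: by end_near. Qed.

(** Distinct sets of equal size each contain an index missing from the other, and the two strict
    comparisons of these indices contradict each other. *)
Lemma open_cell_disjoint (J J' : {set D}) z : #|J| = #|J'| ->
  open_cell J z -> open_cell J' z -> J = J'.
Proof.
move=> cJ [_ [_ zJ]] [_ [_ zJ']]; apply/eqP; rewrite eqEcard cJ leqnn andbT.
apply/fintype.subsetP => c cinJ; apply: contraT => cJ'.
have /fintype.subsetPn[c' c'J' c'J] : ~~ (J' \subset J).
  apply/negP => /(fun s => subset_leqif_cards s) [].
  rewrite cJ eqxx => _ /esym/eqP J'J; by rewrite J'J cinJ in cJ'.
by have := lt_trans (zJ _ _ cinJ c'J) (zJ' _ _ c'J' cJ'); rewrite ltxx.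
Qed.

Definition cells (k : nat) : set (M * M) :=
  [set z | exists2 J : {set D}, #|J| = k & open_cell J z].

Definition the_cell k z : {set D} :=
  odflt finset.set0 [pick J : {set D} | (#|J| == k) && `[< open_cell J z >]].

Lemma the_cellE k (J : {set D}) z : #|J| = k -> open_cell J z -> the_cell k z = J.
Proof.
move=> Jk zJ; rewrite /the_cell; case: pickP => [J' /andP[/eqP J'k /asboolP zJ']|].
  by apply: open_cell_disjoint zJ' zJ; rewrite Jk.
by move=> /(_ J); rewrite Jk eqxx /=; move/asboolP.
Qed.

Definition left_part (J : {set D}) : {set 'I_n} := [set j | inl j \in J]%SET.
Definition right_part (J : {set D}) : {set 'I_n} := [set j | inr j \in J]%SET.

Lemma open_cell_dom J z : open_cell J z ->
  cell_dom (left_part J) z.1 /\ cell_dom (right_part J) z.2.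
Proof.
move=> [J1 [J2 _]]; split; split => j; rewrite inE.
- by move/J1.
- by move/J2.
- by move/J1.
- by move/J2.
Qed.

Definition cells_hom k (w : (M * M) * R) : M * M :=
  let J := the_cell k w.1 in
  (cell_hom (left_part J) (w.1.1, w.2), cell_hom (right_part J) (w.1.2, w.2)).

Lemma near_the_cell k (J : {set D}) z0 : #|J| = k -> open_cell J z0 ->
  \forall z \near z0, open_cell J z /\ the_cell k z = J.
Proof.
move=> Jk zJ; have : nbhs z0 (open_cell J).
  by apply: open_nbhs_nbhs; split => //; exact: open_cell_open.
by apply: filterS => z Jz; split => //; exact: the_cellE.
Qed.

Lemma cells_hom_continuous k z0 t0 : cells k z0 ->
  {for (z0, t0), continuous (cells_hom k)}.
Proof.
move=> [J Jk zJ]; have [zJ1 zJ2] := open_cell_dom zJ.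
pose f (w : (M * M) * R) :=
  (cell_hom (left_part J) (w.1.1, w.2), cell_hom (right_part J) (w.1.2, w.2)).
have fc : {for (z0, t0), continuous f}.
  apply: continuous_at_pair.
    apply: (@continuous_comp _ _ _ (fun w : (M * M) * R => (w.1.1, w.2))
      (cell_hom (left_part J))); last exact: cell_hom_continuous.
    apply: continuous_at_pair; last exact: snd_continuous.
    exact: (continuous_compT (@fst_continuous (M * M)%type R) (@fst_continuous M M)).
  apply: (@continuous_comp _ _ _ (fun w : (M * M) * R => (w.1.2, w.2))
    (cell_hom (right_part J))); last exact: cell_hom_continuous.
  apply: continuous_at_pair; last exact: snd_continuous.
  exact: (continuous_compT (@fst_continuous (M * M)%type R) (@snd_continuous M M)).
refine (@continuous_pw2 _ _ f f (cells_hom k) (z0, t0) fc fc _ _ _).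
- by rewrite /cells_hom /= (the_cellE Jk zJ).
- by rewrite /cells_hom /= (the_cellE Jk zJ).
have H : \forall w \near (z0, t0), open_cell J w.1 /\ the_cell k w.1 = J.
  exact: (@fst_continuous _ R (z0, t0) _ (near_the_cell Jk zJ)).
by apply: filterS H => w [_ wJ]; left; rewrite /cells_hom /= wJ.
Qed.

Lemma near_cells_hom1 k z0 : cells k z0 ->
  \forall z \near z0, cells_hom k (z, 1) = cells_hom k (z0, 1).
Proof.
move=> [J Jk zJ]; have [zJ1 zJ2] := open_cell_dom zJ.
have H1 : \forall z \near z0, cell_hom (left_part J) (z.1, 1) =
    cell_hom (left_part J) (z0.1, 1).
  exact: (@fst_continuous M M z0 _ (near_cell_hom1 zJ1)).
have H2 : \forall z \near z0, cell_hom (right_part J) (z.2, 1) =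
    cell_hom (right_part J) (z0.2, 1).
  exact: (@snd_continuous M M z0 _ (near_cell_hom1 zJ2)).
apply: filterS (filterI (near_the_cell Jk zJ) (filterI H1 H2)).
move=> z [[Jz zE] [/= E1 E2]].
by rewrite /cells_hom /= zE (the_cellE Jk zJ) E1 E2.
Qed.

Lemma cells_motion_planner k : has_motion_planner R (cells k).
Proof.
apply: (motion_planner_null (y := bott_vertex)); apply: homotopic_sym.
pose G (w : (M * M) * R) := let z := cells_hom k (w.1, 1) in
  (vertex_path z.1 w.2, vertex_path z.2 w.2).
have H1 := homotopic_restrict (@cells_hom_continuous k).
(* Near [z] the end of the push does not move, so the path to the vertex is a fixed one. *)
have Gc z t : cells k z -> {for (z, t), continuous G}.
  move=> zk; pose z1 := cells_hom k (z, 1).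
  pose f (w : (M * M) * R) := (vertex_path z1.1 w.2, vertex_path z1.2 w.2).
  have fc : {for (z, t), continuous f}.
    apply: continuous_at_pair;
      exact: (continuous_compT (@snd_continuous (M * M)%type R)
        (@vertex_path_continuous _)).
  refine (@continuous_pw2 _ _ f f G (z, t) fc fc _ _ _) => //.
  have H : \forall w \near (z, t), cells_hom k (w.1, 1) = z1.
    exact: (@fst_continuous _ R (z, t) _ (near_cells_hom1 zk)).
  by apply: filterS H => w wE; left; rewrite /G wE.
have H2 := homotopic_restrict Gc.
have E1 : (fun u : cells k => cells_hom k (set_val u, 0)) = set_val.
  by apply/funext => u; rewrite /cells_hom /= !cell_hom0; case: (set_val u).
have E2 : (fun u : cells k => G (set_val u, 0)) =
    (fun u : cells k => cells_hom k (set_val u, 1)).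
  by apply/funext => u; rewrite /G /= !vertex_path0.
have E3 : (fun u : cells k => G (set_val u, 1)) =
    (fun u => (bott_vertex, bott_vertex)).
  by apply/funext => u; rewrite /G /= !vertex_path1.
rewrite E1 in H1; rewrite E2 E3 in H2.
exact: homotopic_trans H1 H2.
Qed.

Lemma bott_motion_cover : motion_cover R M (n + n).+1.
Proof.
exists (fun k => cells k); split => [k|z|k].
- have -> : cells k = \bigcup_(J in [set J : {set D} | #|J| = k]) open_cell J.
    by apply/seteqP; split => z [J Jk zJ]; exists J.
  by apply: bigcup_open => J _; exact: open_cell_open.
(* The coordinates of [z] that are exactly at an end form a suitable [J]; its size is one of 0, ...,
   2n. *)
- pose J := [set c | edge_dist2 c z == 0]%SET.
  have Jn : (#|J| < (n + n).+1)%N.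
    by rewrite ltnS (leq_trans (max_card _)) // card_sum !card_ord.
  have ge0 c : 0 <= edge_dist2 c z by case: c => j; exact: edge_dist_ge0.
  have J0 c : c \in J -> edge_dist2 c z = 0 by rewrite inE => /eqP.
  have Jp c : c \notin J -> 0 < edge_dist2 c z.
    by rewrite inE lt_neqAle ge0 andbT eq_sym.
  exists (Ordinal Jn), J => //; split; first by move=> c /J0 ->; lra.
  by split => // c c' /J0 -> /Jp.
- exact: cells_motion_planner.
Qed.

End UpperBound.

(** * Parallel transport of lines *)

Section MatrixContinuity.
Variables (R : realType) (X : topologicalType).

Lemma continuous_at_entry m n (f : X -> 'M[R]_(m, n)) x i j :
  {for x, continuous f} -> {for x, continuous (fun z => f z i j)}.
Proof.
move=> fc; apply: (@continuous_comp _ _ _ f (fun T : 'M[R]_(m, n) => T i j)) => //.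
exact: coord_continuous.
Qed.

Lemma continuous_at_mulmx m n p (f : X -> 'M[R]_(m, n)) (g : X -> 'M[R]_(n, p)) x :
  {for x, continuous f} -> {for x, continuous g} ->
  {for x, continuous (fun z => f z *m g z)}.
Proof.
move=> fc gc; apply: continuous_at_mx => i j.
have -> : (fun z => (f z *m g z) i j) = (fun z => \sum_l f z i l * g z l j).
  by apply/funext => w; rewrite mxE.
by apply: continuous_at_sum => l; apply: continuous_at_mul; exact: continuous_at_entry.
Qed.

Lemma continuous_at_trmx m n (f : X -> 'M[R]_(m, n)) x :
  {for x, continuous f} -> {for x, continuous (fun z => (f z)^T)}.
Proof.
move=> fc; apply: continuous_at_mx => i j.
have -> : (fun z => (f z)^T i j) = (fun z => f z j i).
  by apply/funext => w; rewrite mxE.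
exact: continuous_at_entry.
Qed.

End MatrixContinuity.

Section Dot.
Variables (R : realType) (d : nat).
Implicit Types a b c : 'rV[R]_d.

Definition dot a b : R := (a *m b^T) 0 0.

Lemma dotE a b : a *m b^T = (dot a b)%:M.
Proof. exact: mx11_scalar. Qed.

Lemma dotC a b : dot a b = dot b a.
Proof.
by rewrite /dot !mxE; apply: eq_bigr => j _; rewrite !mxE mulrC.
Qed.

Lemma dot_gt0 a : a != 0 -> 0 < dot a a.
Proof.
move=> a0; have [j aj] : exists j, a 0 j != 0.
  apply/existsP; apply: contraNT a0 => /existsPn H.
  by apply/eqP/rowP => j; rewrite mxE; have /negbNE/eqP := H j.
rewrite /dot mxE (bigD1 j) //= mxE -expr2 ltr_wpDr //.
  by apply: sumr_ge0 => i _; rewrite mxE -expr2 sqr_ge0.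
by rewrite exprn_even_gt0.
Qed.

Lemma dot_proj a b c : a *m (b^T *m c) = dot a b *: c.
Proof. by rewrite mulmxA dotE mul_scalar_mx. Qed.

Lemma dotZl x a b : dot (x *: a) b = x * dot a b.
Proof. by rewrite /dot -scalemxAl mxE. Qed.

Lemma dot_same_line a b : a != 0 -> a^T *m a = b^T *m b -> dot a b != 0.
Proof.
move=> a0 ab; have E : dot a a *: a = dot a b *: b by rewrite -!dot_proj ab.
apply: contra_neq a0 => ab0; rewrite ab0 scale0r in E.
apply/eqP; have /eqP := E; rewrite scaler_eq0 => /orP[/eqP aa|//].
by apply: contraT => /dot_gt0; rewrite aa ltxx.
Qed.

(** Tests orthogonality of two lines continuously, from their matrices alone. *)
Lemma trace_proj2 a b : \tr ((a^T *m a) *m (b^T *m b)) = dot a b ^+ 2.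
Proof.
rewrite -mulmxA dot_proj -scalemxAr mxtraceZ mxtrace_mulC dotE.
by rewrite mxtrace_scalar mulr1n dotC expr2.
Qed.

End Dot.

(* [P] is a map to the projective space of lines of ['rV[R]_d], each line being
   given by a matrix [a^T *m a] with [a] on the line. *)
Section Transport.
Variables (R : realType) (d : nat) (Y : topologicalType) (P : Y -> 'M[R]_d).
Hypothesis P_cont : continuous P.
Hypothesis P_line : forall y, exists2 a : 'rV[R]_d, a != 0 & P y = a^T *m a.

Variables (Z : topologicalType) (G : Z * R -> Y).

Definition node (N k : nat) : R := k%:R / N.+1%:R.

(** Discrete parallel transport: a row vector is projected, up to scale, onto the lines at
    successive nodes. Continuity in [z] is then immediate, with no path lifting. *)
Fixpoint transport (N k : nat) (z : Z) : 'M[R]_d :=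
  if k is k'.+1 then transport N k' z *m P (G (z, node N k'.+1))
  else P (G (z, 0)).

Definition chain (N : nat) (z : Z) := forall k, (k < N.+1)%N ->
  0 < \tr (P (G (z, node N k)) *m P (G (z, node N k.+1))).

(** Consecutive lines are not orthogonal, so at each node [a] has become a nonzero multiple of a
    vector on the line there. *)
Lemma transport_neq0 N z a b : chain N z -> a != 0 -> b != 0 ->
  P (G (z, 0)) = a^T *m a -> P (G (z, 1)) = b^T *m b ->
  dot (a *m transport N N.+1 z) b != 0.
Proof.
move=> zN a0 b0 Pa Pb.
have H k : (k <= N.+1)%N -> exists2 c : 'rV[R]_d, c != 0 &
    P (G (z, node N k)) = c^T *m c /\
    exists2 x, x != 0 & a *m transport N k z = x *: c.
  elim: k => [_|k IH kN].
    exists a => //; split; first by rewrite /node mul0r.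
    exists (dot a a); first by rewrite gt_eqF // dot_gt0.
    by rewrite /= Pa dot_proj.
  have [c c0 [Pc [x x0 E]]] := IH (ltnW kN).
  have [c' c'0 Pc'] := P_line (G (z, node N k.+1)).
  exists c' => //; split => //; exists (x * dot c c').
    have := zN k kN; rewrite Pc Pc' trace_proj2 => cc'.
    by rewrite mulf_neq0 //; apply: contraTneq cc' => ->; rewrite expr0n ltxx.
  by rewrite /= mulmxA E Pc' -scalemxAl dot_proj scalerA.
have [c c0 [Pc [x x0 E]]] := H N.+1 (leqnn _).
rewrite E dotZl mulf_neq0 // dot_same_line //.
by rewrite -Pc -Pb /node divff ?pnatr_eq0.
Qed.

Lemma P_self y : 0 < \tr (P y *m P y).
Proof.
by have [a a0 ->] := P_line y; rewrite trace_proj2 exprn_gt0 // dot_gt0.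
Qed.

Variable U : set Z.
Hypothesis G_cont : forall z t, U z -> {for (z, t), continuous G}.

Lemma transport_continuous N k z : U z -> {for z, continuous (transport N k)}.
Proof.
move=> Uz.
have PG t : {for z, continuous (fun z => P (G (z, t)))}.
  apply: (@continuous_comp _ _ _ (fun z => G (z, t)) P); last exact: P_cont.
  apply: (@continuous_comp _ _ _ (fun z => (z, t)) G); last exact: G_cont.
  by apply: continuous_at_pair; [exact: cvg_id|exact: cst_continuous].
elim: k => [|k IH]; first exact: PG.
exact: continuous_at_mulmx.
Qed.

(** A line is not orthogonal to itself, and compactness of the time interval makes this uniform. The
    product filter yields a bound on the number of steps valid on a whole neighbourhood of [z0]. *)
Lemma near_chain z0 : open U -> U z0 ->
  \forall w \near filter_prod (nbhs z0) \oo, U w.1 /\ chain w.2 w.1.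
Proof.
move=> oU Uz0; pose ov (w : Z * (R * R)) :=
  \tr (P (G (w.1, w.2.1)) *m P (G (w.1, w.2.2))).
have ovc t t' : {for (z0, (t, t')), continuous ov}.
  have PG (pr : R * R -> R) : continuous pr ->
      {for (z0, (t, t')), continuous (fun w : Z * (R * R) => P (G (w.1, pr w.2)))}.
    move=> prc; apply: (@continuous_comp _ _ _
      (fun w : Z * (R * R) => G (w.1, pr w.2)) P); last exact: P_cont.
    apply: (@continuous_comp _ _ _
      (fun w : Z * (R * R) => (w.1, pr w.2)) G); last exact: G_cont.
    apply: continuous_at_pair; first exact: fst_continuous.
    exact: (continuous_compT (@snd_continuous Z (R * R)%type) prc).
  apply: continuous_at_sum => i.
  apply: continuous_at_entry; apply: continuous_at_mulmx.
    exact: (PG fst (@fst_continuous R R)).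
  exact: (PG snd (@snd_continuous R R)).
have ov_near (t0 : R) : \forall t \near t0 & w \near filter_prod (nbhs z0) \oo,
    forall t', `|t' - t| <= w.2.+1%:R^-1 -> 0 < ov (w.1, (t, t')).
  have := continuous_at_gt (ovc t0 t0) (P_self (G (z0, t0))).
  case=> -[B C] /= [Bz [[C1 C2] /= [/nbhs_ballP[e1 /= e10 e1C]
    /nbhs_ballP[e2 /= e20 e2C]] CC]] BC.
  have e0 : 0 < Num.min e1 (e2 / 2) by rewrite lt_min e10 divr_gt0.
  exists (ball t0 (Num.min e1 (e2 / 2)),
    B `*` [set N | N.+1%:R^-1 < e2 / 2 :> R]).
    split; first exact: nbhsx_ballx.
    exists (B, [set N | N.+1%:R^-1 < e2 / 2 :> R]) => //; split => //=.
    have e20' : 0 < e2 / 2 by rewrite divr_gt0.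
    exact: (near_infty_natSinv_lt (PosNum e20')).
  move=> [t [z N]] /= [tt0 [Bz' Ne]] t' /= tt'.
  move: tt0; rewrite /ball /= lt_min => /andP[t1 t2].
  apply: (BC (z, (t, t'))); split => //; apply: CC; split => /=.
    exact: e1C.
  apply: e2C; rewrite /ball /=.
  have := ler_normD (t0 - t) (t - t'); rewrite addrA subrK.
  rewrite [`|t - t'|]distrC => tri; apply: le_lt_trans tri _.
  by rewrite [ltRHS]splitr ltrD // (le_lt_trans tt').
have /compact_near_coveringP cov : compact `[0 : R, 1]%classic.
  exact: segment_compact.
have FF := filter_prod_filter (nbhs_filter z0) eventually_filter.
have H := cov (Z * nat)%type (filter_prod (nbhs z0) \oo)
  (fun w t => forall t', `|t' - t| <= w.2.+1%:R^-1 -> 0 < ov (w.1, (t, t')))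
  FF (fun t _ => ov_near t).
have Unear : \forall w \near filter_prod (nbhs z0) \oo, U w.1.
  by exists (U, setT); [split; [exact: open_nbhs_nbhs|exact: filterT]|case=> ? ? []].
have UH := @filterI _ _ FF _ _ Unear H.
apply: (@filterS _ _ FF _ _ _ UH) => -[z N] /= [Uz zN]; split => // k kN.
apply: (zN (node N k)).
  rewrite /= in_itv /= /node divr_ge0 //= ler_pdivrMr ?ltr0n // mul1r ler_nat.
  exact: ltnW.
rewrite /node -mulrBl -natrB // subSnn mul1r ger0_norm // invr_ge0 ler0n.
Qed.


End Transport.

Section SignFunction.
Variables (R : realType) (d : nat) (Y : topologicalType) (P : Y -> 'M[R]_d).
Hypothesis P_cont : continuous P.
Hypothesis P_line : forall y, exists2 a : 'rV[R]_d, a != 0 & P y = a^T *m a.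
Variables (q : nat) (Phi : 'rV[R]_q -> Y * Y) (a b : 'rV[R]_q -> 'rV[R]_d).
Hypothesis Phi_cont : continuous Phi.
Hypothesis (a_cont : continuous a) (b_cont : continuous b).
Hypothesis (a_neq0 : forall v, a v != 0) (b_neq0 : forall v, b v != 0).
Hypothesis Pa : forall v, P (Phi v).1 = (a v)^T *m a v.
Hypothesis Pb : forall v, P (Phi v).2 = (b v)^T *m b v.
Variables (U : set (Y * Y)) (G : (Y * Y) * R -> Y).
Hypothesis G_cont : forall z t, U z -> {for (z, t), continuous G}.
Hypothesis G0 : forall z, U z -> G (z, 0) = z.1.
Hypothesis G1 : forall z, U z -> G (z, 1) = z.2.
Variable N : nat.

Definition good (v : 'rV[R]_q) := U (Phi v) /\ chain P G N (Phi v).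

(* Off the good set, any matrix pairing [a] with [b] nontrivially will do; it
   only has to depend on [Phi v] rather than on [v]. *)
Lemma pairing_exists : exists T : Y * Y -> 'M[R]_d,
  (forall v, dot (a v *m T (Phi v)) (b v) != 0) /\
  (forall v, good v -> T (Phi v) = transport P G N N.+1 (Phi v)).
Proof.
suff /choice[T TP] : forall z, exists T : 'M[R]_d,
    (forall v, Phi v = z -> dot (a v *m T) (b v) != 0) /\
    (forall v, Phi v = z -> good v -> T = transport P G N N.+1 z).
  by exists T; split => v; [have [H _] := TP (Phi v)|have [_ H] := TP (Phi v)];
    exact: H.
move=> z; have [[v0 zv0]|nov] := pselect (exists v, Phi v = z); last first.
  by exists 0; split => v vz; exfalso; apply: nov; exists v.
have [gv0|ngv0] := pselect (good v0).
  exists (transport P G N N.+1 z); split => // v vz.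
  move: gv0; rewrite /good zv0 => -[Uz cz].
  apply: (transport_neq0 P_line cz); rewrite // ?G0 ?G1 //.
    by rewrite -vz Pa.
  by rewrite -vz Pb.
exists ((a v0)^T *m b v0); split => v vz.
  rewrite dot_proj dotZl mulf_neq0 // dot_same_line //.
    by rewrite -!Pa vz zv0.
  by rewrite -!Pb vz zv0.
by rewrite /good vz -zv0 => /ngv0.
Qed.

Lemma const_sign_segment (kap : 'rV[R]_q -> R) v v' :
  (forall t, 0 <= t <= 1 -> {for (v + t *: (v' - v)), continuous kap} /\
    kap (v + t *: (v' - v)) != 0) ->
  (kap v < 0) = (kap v' < 0).
Proof.
move=> H; pose h t := kap (v + t *: (v' - v)).
have hc : {within `[0, 1], continuous h}.
  apply: continuous_in_subspaceT => t; rewrite inE /= in_itv => /H[kc _].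
  apply: (@continuous_comp _ _ _ (fun t : R => v + t *: (v' - v)) kap) => //.
  apply: continuous_at_mx => i j.
  have -> : (fun t => (v + t *: (v' - v)) i j) =
      (fun t => v i j + t * (v' - v) i j).
    by apply/funext => u; rewrite !mxE.
  apply: continuous_at_add; first exact: cst_continuous.
  by apply: continuous_at_mul; [exact: cvg_id|exact: cst_continuous].
have h0 : h 0 = kap v by rewrite /h scale0r addr0.
have h1 : h 1 = kap v' by rewrite /h scale1r addrC subrK.
have nz t : 0 <= t <= 1 -> h t != 0 by move=> /H[].
have ivt : ~ (Num.min (h 0) (h 1) <= 0 <= Num.max (h 0) (h 1)).
  move=> /(IVT ler01 hc)[t]; rewrite in_itv /= => t01 /eqP.
  by apply/negP; exact: nz.
have n0 : h 0 != 0 by apply: nz; rewrite lexx ler01.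
have n1 : h 1 != 0 by apply: nz; rewrite lexx ler01.
rewrite -h0 -h1.
case: (ltgtP (h 0) 0) n0 => // x0 _; case: (ltgtP (h 1) 0) n1 => // x1 _.
- by exfalso; apply: ivt; rewrite ge_min le_max !(ltW x0) !(ltW x1) orbT.
- by exfalso; apply: ivt; rewrite ge_min le_max !(ltW x0) !(ltW x1) orbT.
Qed.

(** [f v] is the sign of the pairing of the transported [a v] with [b v]. Changing the lifts by the
    signs [i] and [j] adds [i (+) j], the value of the zero-divisor of the line class; along good
    segments the pairing is continuous and nonzero, so its sign stays. *)
Lemma sign_function : exists f : 'rV[R]_q -> 'F_2,
  (forall v v' (i j : bool), Phi v = Phi v' -> a v = (-1) ^+ i *: a v' ->
     b v = (-1) ^+ j *: b v' -> f v = f v' + (i (+) j)%:R) /\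
  (forall v v', (forall t, 0 <= t <= 1 -> good (v + t *: (v' - v))) ->
     f v = f v').
Proof.
have [T [T0 TE]] := pairing_exists.
pose kap v := dot (a v *m T (Phi v)) (b v).
exists (fun v => (kap v < 0)%R%:R); split.
  move=> v v' i j vv' av bv.
  have -> : kap v = (-1) ^+ (i (+) j) * kap v'.
    rewrite /kap vv' av bv -scalemxAl dotZl dotC dotZl dotC mulrA.
    by rewrite -signr_addb.
  have := T0 v'; rewrite -/(kap v'); case: (i (+) j) => /=; last first.
    by rewrite expr0 mul1r addr0.
  rewrite expr1 mulN1r oppr_lt0; case: ltgtP => // _ _; exact/val_inj.
move=> v v' gd; congr (_%:R); congr nat_of_bool.
pose kapN v := dot (a v *m transport P G N N.+1 (Phi v)) (b v).
have kapE w : good w -> kap w = kapN w by move=> gw; rewrite /kap TE.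
have g0 : good v by have := gd 0; rewrite scale0r addr0 lexx ler01; exact.
have g1 : good v'.
  by have := gd 1; rewrite scale1r addrC subrK lexx ler01; exact.
rewrite (kapE _ g0) (kapE _ g1).
apply: const_sign_segment => t /gd g; split; last by rewrite -kapE //; exact: T0.
have [Uw _] := g; apply: continuous_at_entry; apply: continuous_at_mulmx.
  apply: continuous_at_mulmx; first exact: a_cont.
  apply: (@continuous_comp _ _ _ Phi (transport P G N N.+1)).
    exact: Phi_cont.
  by apply: transport_continuous Uw; [exact: P_cont|exact: G_cont].
apply: continuous_at_trmx; exact: b_cont.
Qed.

End SignFunction.

(** * The lower bound *)

Section LineField.
Variables (R : realType) (n : nat) (A : bottMatrix n).
Local Notation M := (realBott R A).
Local Notation pt := (@bott_pt R n A).
Variables (d : nat) (vec : 'rV[R]_n -> 'cV['F_2]_n -> 'rV[R]_d).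

(** A map from the manifold to real projective space, given by a vector on each copy of the cube:
    crossing a facet may change the sign of the vector but not its line. The signs record the class
    of degree 1 of the line bundle. *)
Definition twisted_vec := [/\ forall x g, cube x -> vec x g != 0,
  forall g, continuous (vec^~ g) &
  forall x j (b : bool), cube x -> x 0 j = b%:R ->
    exists s : bool, forall g, vec x (g + bott_char A (j, b)) = (-1) ^+ s *: vec x g].

Hypothesis vecP : twisted_vec.

Definition line_of (m : M) : 'M[R]_d :=
  (vec (bott_coord m) (bott_label m))^T *m vec (bott_coord m) (bott_label m).

Lemma line_of_pt x g : cube x -> line_of (pt x g) = (vec x g)^T *m vec x g.
Proof.
have [_ _ vecF] := vecP.
move=> cx; rewrite /line_of bott_coordK //; have := @bott_labelK R n A x g cx.
set h := bott_label _; move=> hg.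
suff : exists s : bool, vec x (g + (h - g)) = (-1) ^+ s *: vec x g.
  rewrite addrCA subrr addr0 => -[s ->].
  rewrite -scalemxAr [(_ *: _)^T]linearZ /= -scalemxAl scalerA.
  by rewrite -signr_addb addbb scale1r.
move: (h - g) hg; apply: (bott_grp_ind (Q := fun k =>
  exists s : bool, vec x (g + k) = (-1) ^+ s *: vec x g)) => [|j b k].
  by exists false; rewrite addr0 scale1r.
rewrite cube_clampK // => xj [s E]; have [s' E'] := vecF x j b cx xj.
by exists (s' (+) s); rewrite addrA E' E scalerA -signr_addb.
Qed.

Lemma line_of_line m : exists2 a : 'rV[R]_d, a != 0 & line_of m = a^T *m a.
Proof.
have [vec0 _ _] := vecP; eexists; last by [].
by apply: vec0; exact: bott_coord_cube.
Qed.

Lemma line_of_continuous : continuous line_of.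
Proof.
have [_ vecC _] := vecP.
move=> m S; have [x0 [g0 [cx0 ->]]] := bott_ptE m => nS.
apply: near_bott_pt => // g gG.
have E : pt x0 g0 = pt x0 g by apply: bott_pt_eq.
have {}nS : nbhs ((vec x0 g)^T *m vec x0 g) S by move: nS; rewrite /= E line_of_pt.
have cV : {for x0, continuous (fun x => (vec x g)^T *m vec x g)}.
  apply: continuous_at_mulmx; last exact: vecC.
  by apply: continuous_at_trmx; exact: vecC.
have {}nS : \forall x \near x0, S ((vec x g)^T *m vec x g) by exact: cV.
by apply: filterS nS => x xS cx; rewrite /= line_of_pt.
Qed.

End LineField.

(** * Unfolding doubled intervals into circles *)

Section Unfold.
Variables (R : realType) (n : nat) (A : bottMatrix n).
Local Notation M := (realBott R A).
Local Notation pt := (@bott_pt R n A).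
Implicit Types (x : 'rV[R]_n).

(* Meaningful on [[0, 2]] only; the outer maximum makes it a total map to
   [[0, 1]]. *)
Definition tent (t : R) : R := Num.max 0 (Num.min t (2 - t)).

Definition fold x : 'rV[R]_n := \row_j tent (x 0 j).
Definition fold_label x : 'cV['F_2]_n := \col_j (1 < x 0 j)%R%:R.

(** As a coordinate runs over [[0, 2]], it goes through copy 0 of the interval and back through copy
    1; the copies meet at 1 because F_1^j carries e_j. *)
Definition unfold x : M := pt (fold x) (fold_label x).

Lemma tent_bound t : 0 <= tent t <= 1.
Proof.
rewrite /tent le_max lexx ge_max ler01 ge_min /=.
by have [//|/ltW] := leP t 1; lra.
Qed.

Lemma fold_cube x : cube (fold x).
Proof. by move=> j; rewrite mxE tent_bound. Qed.

Lemma tent_continuous : continuous tent.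
Proof.
move=> t; apply: (@continuous_max _ _ (fun=> 0) (fun t : R => Num.min t (2 - t))).
  exact: cst_continuous.
apply: (@continuous_min _ _ id (fun t : R => 2 - t)); first exact: cvg_id.
by apply: continuous_at_sub; [exact: cst_continuous|exact: cvg_id].
Qed.

Lemma fold_continuous : continuous fold.
Proof.
move=> x; apply: continuous_at_mx => i j.
have -> : (fun x => fold x i j) = (fun x : 'rV[R]_n => tent (x 0 j)).
  by apply/funext => y; rewrite mxE.
apply: (continuous_compT (@coord_continuous R 1 n 0 j) tent_continuous).
Qed.

Lemma fold_grp_facet x j (b : bool) : tent (x 0 j) = b%:R ->
  bott_char A (j, b) \in bott_grp A (fold x).
Proof.
by move=> xj; apply: bott_grp_facet; rewrite cube_clampK ?mxE //; exact: fold_cube.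
Qed.

Lemma unfold_continuous : continuous unfold.
Proof.
move=> x0; apply: (@bott_pt_cvg R n A _ (nbhs x0) _ fold fold_label).
  exact: fold_continuous.
have H j : \forall x \near x0, tent (x0 0 j) != 1 ->
    (1 < (x : 'rV[R]_n) 0 j) = (1 < x0 0 j).
  have [x1|x1|x1] := ltgtP (x0 0 j) 1.
  - have := continuous_at_lt (@coord_continuous R 1 n 0 j x0) x1.
    by apply: filterS => x xj _; rewrite ltNge ltW.
  - have := continuous_at_gt (@coord_continuous R 1 n 0 j x0) x1.
    by apply: filterS => x xj _.
  - near=> x => /negP[]; rewrite x1 /tent.
    have -> : 2 - 1 = 1 :> R by lra.
    by rewrite minxx max_r ?ler01.
have := filter_forall (nbhs_filter x0) H; apply: filterS => x xH.
rewrite [_ - _]matrix_sum_delta; apply: memv_suml => j _; apply: memv_suml => k _.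
rewrite ord1 !mxE; have [t1|t1] := eqVneq (tent (x0 0 j)) 1; last first.
  by rewrite xH // subrr scale0r mem0v.
by apply: memvZ; apply: (fold_grp_facet (b := true)).
Unshelve. all: by end_near. Qed.

Lemma unfold_eq x x' : fold x = fold x' ->
  fold_label x' - fold_label x \in bott_grp A (fold x) -> unfold x = unfold x'.
Proof. by move=> ff gg; rewrite /unfold -ff; exact: bott_pt_eq. Qed.

Definition coil j x (g : 'cV['F_2]_n) : R := (-1) ^+ (g j 0 != 0) * (1 - x 0 j).

Lemma coilD j x g h :
  coil j x (g + h) = (-1) ^+ (h j 0 != 0) * coil j x g.
Proof.
rewrite /coil mxE mulrA -signr_addb; congr (_ ^+ _ * _).
by case: (g j 0) => [[|[|?]]] // ?; case: (h j 0) => [[|[|?]]].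
Qed.

Definition tilt (t : R) : R := Num.max (- 1) (Num.min 1 (1 - t)).

(** The label jumps at 1, but the coil vanishes there, so the composite is continuous. *)
Lemma coil_fold j x : coil j (fold x) (fold_label x) = tilt (x 0 j).
Proof.
rewrite /coil !mxE /tilt /tent.
have -> : ((1 < x 0 j)%R%:R != 0 :> 'F_2) = (1 < x 0 j) by case: (1 < _).
have [x1|x1] := ltP 1 (x 0 j).
  rewrite expr1 (min_r (x := x 0 j)); last by lra.
  rewrite (min_r (x := 1)); last by lra.
  by have [?|?] := leP 0 (2 - x 0 j); have [?|?] := leP (- 1) (1 - x 0 j); lra.
rewrite expr0 (min_l (x := x 0 j)); last by lra.
have [?|?] := leP 0 (x 0 j); have [?|?] := leP 1 (1 - x 0 j);
  rewrite ?(max_r (x := - 1)); lra.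
Qed.

Lemma tilt_continuous : continuous tilt.
Proof.
move=> t; apply: (@continuous_max _ _ (fun=> - 1) (fun t : R => Num.min 1 (1 - t))).
  exact: cst_continuous.
apply: (@continuous_min _ _ (fun=> 1) (fun t : R => 1 - t)).
  exact: cst_continuous.
by apply: continuous_at_sub; [exact: cst_continuous|exact: cvg_id].
Qed.

Lemma tilt_rev t : tilt (2 - t) = - tilt t.
Proof.
rewrite /tilt; have [?|?] := leP 1 (1 - t); have [?|?] := leP 1 (1 - (2 - t));
  have [?|?] := leP (- 1) (1 : R); have [?|?] := leP (- 1) (1 - t);
  have [?|?] := leP (- 1) (1 - (2 - t)); lra.
Qed.

Lemma tent_rev t : tent (2 - t) = tent t.
Proof. by rewrite /tent minC; congr (Num.max 0 (Num.min _ _)); lra. Qed.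

Lemma tilt0 : tilt 0 = 1.
Proof. by rewrite /tilt subr0 minxx max_r //; lra. Qed.

Lemma tilt2 : tilt 2 = - 1.
Proof. by rewrite -[2]subr0 tilt_rev tilt0. Qed.

Lemma tent0 : tent 0 = 0.
Proof. by rewrite /tent min_l ?maxxx //; lra. Qed.

Lemma tent2 : tent 2 = 0.
Proof. by rewrite -[2]subr0 tent_rev tent0. Qed.

Lemma tent1 : tent 1 = 1.
Proof. by rewrite /tent min_l ?max_r //; lra. Qed.

Lemma coil_continuous j g : continuous (coil j ^~ g).
Proof.
move=> x; apply: (@continuous_at_mul R _ (fun=> (-1) ^+ (g j 0 != 0))
  (fun x : 'rV[R]_n => 1 - x 0 j)); first exact: cst_continuous.
by apply: continuous_at_sub; [exact: cst_continuous|exact: coord_continuous].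
Qed.


(** Goes from (1, 0) through (0, 1) to (-1, 0) around circle [j]: the line makes a half-turn, as in
    the Moebius bundle. *)
Definition circle_vec j x g : 'rV[R]_2 := \row_i [tuple coil j x g; x 0 j]`_i.

End Unfold.

Lemma ord3_cases (a b c i : 'I_3) : a != b -> a != c -> b != c ->
  [\/ i = a, i = b | i = c].
Proof.
move=> ab ac bc; have [ia|ia] := eqVneq i a; first by constructor 1.
have [ib|ib] := eqVneq i b; first by constructor 2.
constructor 3; apply: val_inj; move: ab ac bc ia ib; rewrite -!val_eqE /=.
by move: (ltn_ord a) (ltn_ord b) (ltn_ord c) (ltn_ord i); lia.
Qed.

(** * The threefolds: line fields, test map and lower bound *)

Section Threefold.
Variables (R : realType) (A : bottMatrix 3) (a b c : 'I_3) (eps : bool).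
Hypothesis abc : [/\ a != b, a != c & b != c].
Hypothesis AE : forall i j, A i j =
  ((i == j) || (i == b) && ((j == a) || eps && (j == c)))%:R.
Local Notation M := (realBott R A).
Local Notation pt := (@bott_pt R 3 A).

Lemma bott_char_bit j (bb : bool) i : (bott_char A (j, bb) i 0 != 0) =
  (i == j) || ~~ bb && (i == b) && ((j == a) || eps && (j == c)).
Proof.
rewrite /bott_char /=; case: bb; rewrite !mxE ?AE /=.
  by rewrite andbT orbF; case: (i == j).
by case: (_ || _).
Qed.

Lemma coil0 j (x : 'rV[R]_3) (g : 'cV['F_2]_3) : x 0 j = 1 -> coil j x g = 0 :> R.
Proof. by rewrite /coil => ->; rewrite subrr mulr0. Qed.

Lemma coil_eq0 j (x : 'rV[R]_3) (g : 'cV['F_2]_3) : (coil j x g == 0 :> R) = (x 0 j == 1).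
Proof. by rewrite /coil mulf_eq0 signr_eq0 /= subr_eq0 eq_sym. Qed.

Lemma circle_vec_twisted j : j != b -> twisted_vec A (@circle_vec R 3 j).
Proof.
move=> jb; split.
- move=> x g _; apply/negP => /eqP /rowP v0.
  have := v0 ord0; have := v0 (lift ord0 ord0); rewrite !mxE /= => x0 /eqP.
  by rewrite coil_eq0 x0 eq_sym oner_eq0.
- move=> g x; apply: continuous_at_mx => i k.
  have -> : (fun x => circle_vec j x g i k) =
      (fun x : 'rV[R]_3 => [tuple coil j x g; x 0 j]`_k).
    by apply/funext => y; rewrite mxE.
  case: k => [[|[|//]] ?] /=; first exact: coil_continuous.
  exact: coord_continuous.
- move=> x k bb cx xk; exists (~~ bb && (k == j)) => g.
  apply/rowP => i; rewrite !mxE; case: i => [[|[|//]] ?] /=.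
    rewrite coilD bott_char_bit (negbTE jb) andbF /= orbF.
    have [kj|//] := eqVneq k j; rewrite ?andbF //= andbT.
    case: bb xk => //= xk; by rewrite coil0 ?mulr0 // -kj xk.
  have [kj|] := eqVneq k j; last by rewrite andbF expr0 mul1r.
  rewrite andbT -kj xk; case: bb {xk} => /=; first by rewrite expr0 mul1r.
  by rewrite mulr0.
Qed.

(** The vector (coil b, x_b) alone does not work: crossing F_0^a reverses only its first entry.
    Tensoring the second entry with the line field of [a], and with that of [c] if [eps], makes it
    change sign too. *)
Definition fiber_vec (x : 'rV[R]_3) (g : 'cV['F_2]_3) : 'rV[R]_5 :=
  let cc := if eps then coil c x g else 1 in
  let sc := if eps then x 0 c else 0 in
  \row_i [tuple coil b x g; x 0 b * (coil a x g * cc); x 0 b * (x 0 a * cc);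
    x 0 b * (coil a x g * sc); x 0 b * (x 0 a * sc)]`_i.

Lemma coil_coord_neq0 j (x : 'rV[R]_3) (g : 'cV['F_2]_3) :
  coil j x g = 0 -> x 0 j != 0.
Proof. by move/eqP; rewrite coil_eq0 => /eqP ->; exact: oner_neq0. Qed.

Lemma fiber_vec_neq0 x g : fiber_vec x g != 0.
Proof.
apply/negP => /eqP /rowP v0.
have := v0 (inord 0); rewrite !mxE inordK //= => /coil_coord_neq0 xb.
have cc0 (y z : R) : x 0 b * (y * z) = 0 -> (y == 0) || (z == 0).
  by move=> /eqP; rewrite mulf_eq0 (negbTE xb) mulf_eq0.
have := v0 (inord 1); rewrite !mxE inordK //= => /cc0 v1.
have := v0 (inord 2); rewrite !mxE inordK //= => /cc0 v2.
have := v0 (inord 3); rewrite !mxE inordK //= => /cc0 v3.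
have := v0 (inord 4); rewrite !mxE inordK //= => /cc0 v4.
have [ca|ca] := eqVneq (coil a x g) 0.
  have xa := coil_coord_neq0 ca; move: v2 v4; rewrite (negbTE xa) /=.
  case: eps => [/eqP /coil_coord_neq0 /negbTE ->//|]; by rewrite oner_eq0.
move: v1 v3; rewrite (negbTE ca) /=.
case: eps => [/eqP /coil_coord_neq0 /negbTE ->//|]; by rewrite oner_eq0.
Qed.

Lemma fiber_vec_twisted : twisted_vec A fiber_vec.
Proof.
have [ab ac bc] := abc; split.
- by move=> x g _; exact: fiber_vec_neq0.
- move=> g x; apply: continuous_at_mx => i k.
  have -> : (fun x => fiber_vec x g i k) = (fun x : 'rV[R]_3 =>
    [tuple coil b x g; x 0 b * (coil a x g * (if eps then coil c x g else 1));
      x 0 b * (x 0 a * (if eps then coil c x g else 1));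
      x 0 b * (coil a x g * (if eps then x 0 c else 0));
      x 0 b * (x 0 a * (if eps then x 0 c else 0))]`_k).
    by apply/funext => y; rewrite mxE.
  have X j : {for x, continuous (fun x : 'rV[R]_3 => x 0 j)}.
    exact: coord_continuous.
  have C j : {for x, continuous (fun x : 'rV[R]_3 => coil j x g)}.
    exact: coil_continuous.
  have K (r : R) : {for x, continuous (fun x : 'rV[R]_3 => r)}.
    exact: cst_continuous.
  have Cc : {for x, continuous (fun x => if eps then coil c x g else 1)}.
    by case: eps; [exact: C|exact: K].
  have Xc : {for x, continuous (fun x : 'rV[R]_3 => if eps then x 0 c else 0)}.
    by case: eps; [exact: X|exact: K].
  case: k => [[|[|[|[|[|//]]]]] ?] /=; first exact: C.
  + exact: continuous_at_mul (X b) (continuous_at_mul (C a) Cc).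
  + exact: continuous_at_mul (X b) (continuous_at_mul (X a) Cc).
  + exact: continuous_at_mul (X b) (continuous_at_mul (C a) Xc).
  + exact: continuous_at_mul (X b) (continuous_at_mul (X a) Xc).
- move=> x k bb cx xk.
  exists (~~ bb && ((k == b) || (k == a) || eps && (k == c))) => g.
  have eqs := ((negbTE ab), (negbTE ac), (negbTE bc), eqxx,
    (eq_sym b a), (eq_sym c a), (eq_sym c b)).
  case: bb xk => [|xk].
    rewrite mulr1n => xk; apply/rowP => i; rewrite !mxE /= !coilD !bott_char_bit /=.
    rewrite expr0 mul1r.
    have coilk j : (-1) ^+ ((j == k) || false) * coil j x g = coil j x g.
      by rewrite orbF; case: eqVneq => [->|_]; rewrite ?expr0 ?mul1r // coil0 ?mulr0.
    by rewrite !coilk.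
  rewrite mulr0n in xk; apply/rowP => i; rewrite !mxE /= !coilD !bott_char_bit /=.
  have [kk|kk|kk] := ord3_cases k ab ac bc; rewrite {}kk !eqs /= in xk *;
    case: eps; case: i => [[|[|[|[|[|//]]]]] ?] /=;
    rewrite ?xk ?expr0 ?expr1; ring.
Qed.


(* The first factor of the test map sweeps a Klein bottle, the second a torus;
   [a], [b], [c] are the base, fibre and remaining coordinates. *)
Definition base_fiber s t : 'rV[R]_3 :=
  \row_i if i == a then s else if i == b then t else 0.
Definition base_other u w : 'rV[R]_3 :=
  \row_i if i == a then u else if i == c then w else 0.

(** Column [a] of the Bott matrix is e_a + e_b, so closing the base circle reverses the fibre
    circle. *)
Lemma unfold_base_fiber_flip t :
  unfold A (base_fiber 2 t) = unfold A (base_fiber 0 (2 - t)).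
Proof.
have [ab ac bc] := abc.
have eqs := (negbTE ab, negbTE ac, negbTE bc, eqxx, eq_sym b a, eq_sym c a, eq_sym c b).
apply: unfold_eq.
  apply/rowP => i; rewrite !mxE; case: ifP => _; first by rewrite tent0 tent2.
  by case: ifP => // _; rewrite tent_rev.
(* At [t = 1] the reflection leaves the label of the fibre unchanged; the surplus e_b is absorbed by
   F_1^b. *)
have -> : fold_label (base_fiber 0 (2 - t)) - fold_label (base_fiber 2 t) =
    bott_char A (a, false) + (t == 1)%:R *: bott_char A (b, true).
  apply/colP => i; rewrite !mxE AE.
  have [->|->|->] := ord3_cases i ab ac bc; rewrite !eqs /= ?mulr0 ?addr0.
  - have -> : (1 < 0 :> R) = false by apply/negP; lra.
    have -> : 1 < 2 :> R by lra.
    exact/val_inj.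
  - rewrite mulr1; have [t1|t1|->] := ltgtP t 1.
    + have -> : 1 < 2 - t by lra.
      exact/val_inj.
    + have -> : (1 < 2 - t) = false by apply/negP; lra.
      exact/val_inj.
    + have -> : (1 < 2 - 1 :> R) = false by apply/negP; lra.
      exact/val_inj.
  - have -> : (1 < 0 :> R) = false by apply/negP; lra.
    exact/val_inj.
apply: memvD; first by apply: fold_grp_facet; rewrite mxE eqxx tent2.
have [t1|_] := eqVneq t 1; last by rewrite scale0r mem0v.
by apply: memvZ; apply: fold_grp_facet; rewrite mxE !eqs t1 tent1.
Qed.

Lemma unfold_base_fiber_cut s :
  unfold A (base_fiber s 2) = unfold A (base_fiber s 0).
Proof.
have [ab ac bc] := abc.
have eqs := (negbTE ab, negbTE ac, negbTE bc, eqxx, eq_sym b a, eq_sym c a, eq_sym c b).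
apply: unfold_eq.
  apply/rowP => i; rewrite !mxE; case: ifP => // _.
  by case: ifP => // _; rewrite tent0 tent2.
have -> : fold_label (base_fiber s 0) - fold_label (base_fiber s 2) =
    bott_char A (b, false).
  apply/colP => i; rewrite !mxE AE.
  have r0 : (1 < 0 :> R) = false by apply/negP; lra.
  have r2 : 1 < 2 :> R by lra.
  have [->|->|->] := ord3_cases i ab ac bc; rewrite !eqs /= ?subrr ?r0 ?r2 //;
  exact/val_inj.
by apply: fold_grp_facet; rewrite mxE !eqs tent2.
Qed.

(** On this torus coordinate [b] is 0, and F_0^b absorbs the entry e_b of column [a]: there is no
    flip. *)
Lemma unfold_base_other_cut w :
  unfold A (base_other 2 w) = unfold A (base_other 0 w).
Proof.
have [ab ac bc] := abc.
have eqs := (negbTE ab, negbTE ac, negbTE bc, eqxx, eq_sym b a, eq_sym c a, eq_sym c b).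
apply: unfold_eq.
  by apply/rowP => i; rewrite !mxE; case: ifP => // _; rewrite tent0 tent2.
have -> : fold_label (base_other 0 w) - fold_label (base_other 2 w) =
    bott_char A (a, false) + bott_char A (b, false).
  apply/colP => i; rewrite !mxE !AE.
  have r0 : (1 < 0 :> R) = false by apply/negP; lra.
  have r2 : 1 < 2 :> R by lra.
  have [->|->|->] := ord3_cases i ab ac bc; rewrite !eqs /= ?subrr ?r0 ?r2 //;
  exact/val_inj.
by apply: memvD; apply: fold_grp_facet; rewrite mxE !eqs ?tent2 ?tent0.
Qed.

Lemma unfold_base_other_cut2 u :
  unfold A (base_other u 2) = unfold A (base_other u 0).
Proof.
have [ab ac bc] := abc.
have eqs := (negbTE ab, negbTE ac, negbTE bc, eqxx, eq_sym b a, eq_sym c a, eq_sym c b).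
apply: unfold_eq.
  apply/rowP => i; rewrite !mxE; case: ifP => // _.
  by case: ifP => // _; rewrite tent0 tent2.
have -> : fold_label (base_other u 0) - fold_label (base_other u 2) =
    bott_char A (c, false) + eps%:R *: bott_char A (b, false).
  apply/colP => i; rewrite !mxE !AE.
  have r0 : (1 < 0 :> R) = false by apply/negP; lra.
  have r2 : 1 < 2 :> R by lra.
  have [->|->|->] := ord3_cases i ab ac bc; rewrite !eqs /= ?subrr ?r0 ?r2 //;
  case: eps; exact/val_inj.
by apply: memvD; [|apply: memvZ]; apply: fold_grp_facet;
  rewrite mxE !eqs ?tent2 ?tent0.
Qed.

Section Flips.
Variables (d : nat) (vec : 'rV[R]_3 -> 'cV['F_2]_3 -> 'rV[R]_d).
Let V x := vec (fold x) (fold_label x).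
Variables e0 e1 e2 e3 : bool.

Definition flips := [/\
  forall t, V (base_fiber 2 t) = (-1) ^+ e0 *: V (base_fiber 0 (2 - t)),
  forall s, V (base_fiber s 2) = (-1) ^+ e1 *: V (base_fiber s 0),
  forall w, V (base_other 2 w) = (-1) ^+ e2 *: V (base_other 0 w) &
  forall u, V (base_other u 2) = (-1) ^+ e3 *: V (base_other u 0)].

End Flips.

(** The last two signs are trivial because [x 0 b] is 0 on the torus, where the vector is constantly
    the first basis vector. *)
Lemma flips_fiber : flips fiber_vec true true false false.
Proof.
have [ab ac bc] := abc.
have eqs := (negbTE ab, negbTE ac, negbTE bc, eqxx, eq_sym b a, eq_sym c a, eq_sym c b).
by split => y; apply/rowP => i; rewrite !mxE /= !coil_fold !mxE !eqs
  ?tent_rev ?tilt_rev ?tilt2 ?tilt0 ?tent0 ?tent2;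
  case: i => [[|[|[|[|[|//]]]]] ?] /=; ring.
Qed.

Lemma flips_base : flips (@circle_vec R 3 a) true false true false.
Proof.
have [ab ac bc] := abc.
have eqs := (negbTE ab, negbTE ac, negbTE bc, eqxx, eq_sym b a, eq_sym c a, eq_sym c b).
by split => y; apply/rowP => i; rewrite !mxE /= !coil_fold !mxE !eqs
  ?tent_rev ?tilt_rev ?tilt2 ?tilt0 ?tent0 ?tent2;
  case: i => [[|[|//]] ?] /=; ring.
Qed.

Lemma flips_other : flips (@circle_vec R 3 c) false false false true.
Proof.
have [ab ac bc] := abc.
have eqs := (negbTE ab, negbTE ac, negbTE bc, eqxx, eq_sym b a, eq_sym c a, eq_sym c b).
by split => y; apply/rowP => i; rewrite !mxE /= !coil_fold !mxE !eqs
  ?tent_rev ?tilt_rev ?tilt2 ?tilt0 ?tent0 ?tent2;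
  case: i => [[|[|//]] ?] /=; ring.
Qed.


Definition vcoord (v : 'rV[R]_4) (k : nat) : R := v 0 (inord k).
Definition test_map (v : 'rV[R]_4) : M * M :=
  (unfold A (base_fiber (vcoord v 0) (vcoord v 1)),
   unfold A (base_other (vcoord v 2) (vcoord v 3))).

Lemma base_fiber_continuous :
  continuous (fun v : 'rV[R]_4 => base_fiber (vcoord v 0) (vcoord v 1)).
Proof.
move=> v; apply: continuous_at_mx => i j.
have -> : (fun v : 'rV[R]_4 => base_fiber (vcoord v 0) (vcoord v 1) i j) =
    (fun v => if j == a then vcoord v 0 else if j == b then vcoord v 1 else 0).
  by apply/funext => w; rewrite mxE.
case: (j == a); first exact: coord_continuous.
by case: (j == b); [exact: coord_continuous|exact: cst_continuous].
Qed.

Lemma base_other_continuous :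
  continuous (fun v : 'rV[R]_4 => base_other (vcoord v 2) (vcoord v 3)).
Proof.
move=> v; apply: continuous_at_mx => i j.
have -> : (fun v : 'rV[R]_4 => base_other (vcoord v 2) (vcoord v 3) i j) =
    (fun v => if j == a then vcoord v 2 else if j == c then vcoord v 3 else 0).
  by apply/funext => w; rewrite mxE.
case: (j == a); first exact: coord_continuous.
by case: (j == c); [exact: coord_continuous|exact: cst_continuous].
Qed.

Lemma test_map_continuous : continuous test_map.
Proof.
move=> v; apply: (@continuous_at_pair _ M M
  (fun v => unfold A (base_fiber (vcoord v 0) (vcoord v 1)))
  (fun v => unfold A (base_other (vcoord v 2) (vcoord v 3)))).
  exact: (continuous_compT base_fiber_continuous (@unfold_continuous R 3 A)).
exact: (continuous_compT base_other_continuous (@unfold_continuous R 3 A)).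
Qed.

(** Indices up to [N.+1.*2] fill [[0, 2]], and a cell extends by [N.+1%:R^-1] on either side of its
    centre. *)
Definition grid_pt (N : nat) (p : nat -> nat) : 'rV[R]_4 :=
  \row_(j < 4) ((p j)%:R / N.+1%:R).

Lemma vcoord_grid N p k : (k < 4)%N -> vcoord (grid_pt N p) k = (p k)%:R / N.+1%:R.
Proof. by move=> k4; rewrite /vcoord mxE inordK. Qed.

Section ClassData.
Variables (d : nat) (vec : 'rV[R]_3 -> 'cV['F_2]_3 -> 'rV[R]_d).
Variables e0 e1 e2 e3 : bool.
Hypothesis vecP : twisted_vec A vec.
Let V x := vec (fold x) (fold_label x).
Hypothesis V_cont : continuous V.
Hypothesis vec_flips : flips vec e0 e1 e2 e3.

(** [good] is obtained before [N], which compactness will fix only once all four classes are at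
    hand. *)
Lemma planner_sign (U : set (M * M)) : open U -> has_motion_planner R U ->
  exists good : nat -> M * M -> Prop,
    (forall z0, U z0 ->
       \forall w \near filter_prod (nbhs z0) \oo, good w.2 w.1) /\
    (forall N, exists f : 'rV[R]_4 -> 'F_2,
       glued N.+1.*2 (fun p => f (grid_pt N p)) e0%:R e1%:R e2%:R e3%:R /\
       (forall v v',
          (forall t, 0 <= t <= 1 -> good N (test_map (v + t *: (v' - v)))) ->
          f v = f v')).
Proof.
move=> oU /(motion_planner_extend oU)[G [Gc G0 G1]].
exists (fun N z => U z /\ chain (line_of vec) G N z); split.
  move=> z0 Uz0; apply: near_chain => //; first exact: line_of_continuous.
  exact: line_of_line.
move=> N; have [vec0 _ _] := vecP.
have [f [fglue fconst]] := @sign_function R d M (line_of vec)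
  (line_of_continuous vecP) (line_of_line vecP) 4 test_map
  (fun v => V (base_fiber (vcoord v 0) (vcoord v 1)))
  (fun v => V (base_other (vcoord v 2) (vcoord v 3)))
  test_map_continuous
  (continuous_compT base_fiber_continuous V_cont)
  (continuous_compT base_other_continuous V_cont)
  (fun v => vec0 _ _ (fold_cube _)) (fun v => vec0 _ _ (fold_cube _))
  (fun v => line_of_pt vecP _ (fold_cube _))
  (fun v => line_of_pt vecP _ (fold_cube _)) U G Gc G0 G1 N.
exists f; split; last exact: fconst.
have [F0 F1 F2 F3] := vec_flips.
have top : (N.+1.*2)%:R / N.+1%:R = 2 :> R.
  by rewrite -muln2 natrM mulrAC divff ?mul1r // pnatr_eq0.
move=> p pn.
have id0 (x : 'rV[R]_d) : x = (-1) ^+ false *: x by rewrite scale1r.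
split=> pk.
- have E0 : vcoord (grid_pt N p) 0 = 2 by rewrite vcoord_grid // pk top.
  have E k : (1 < k < 4)%N -> vcoord (grid_pt N (glue0 N.+1.*2 p)) k =
      vcoord (grid_pt N p) k.
    by move=> k4; rewrite !vcoord_grid /glue0 ?upd_neq //; lia.
  have E0' : vcoord (grid_pt N (glue0 N.+1.*2 p)) 0 = 0.
    by rewrite vcoord_grid // /glue0 upd_neq // upd_eq mul0r.
  have E1' : vcoord (grid_pt N (glue0 N.+1.*2 p)) 1 = 2 - vcoord (grid_pt N p) 1.
    by rewrite !vcoord_grid // /glue0 upd_eq natrB // mulrBl top.
  (* The first two gluings move only the first point of the test map and the last two only the
     second, so one of the two lifts always keeps its sign. *)
  rewrite (fglue _ (grid_pt N (glue0 N.+1.*2 p)) e0 false) ?addbF //.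
  + by rewrite /test_map E0 E0' E1' !E // unfold_base_fiber_flip.
  + by rewrite E0 E0' E1'; exact: F0.
  + by rewrite !E.
- have E0 : vcoord (grid_pt N p) 1 = 2 by rewrite vcoord_grid // pk top.
  have E k : (k != 1)%N -> (k < 4)%N -> vcoord (grid_pt N (upd p 1%N 0%N)) k =
      vcoord (grid_pt N p) k.
    by move=> k1 k4; rewrite !vcoord_grid ?upd_neq.
  have E0' : vcoord (grid_pt N (upd p 1%N 0%N)) 1 = 0.
    by rewrite vcoord_grid // upd_eq mul0r.
  rewrite (fglue _ (grid_pt N (upd p 1%N 0%N)) e1 false) ?addbF //.
  + by rewrite /test_map E0 E0' !E // unfold_base_fiber_cut.
  + by rewrite E0 E0' !E //; exact: F1.
  + by rewrite !E.
- have E0 : vcoord (grid_pt N p) 2 = 2 by rewrite vcoord_grid // pk top.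
  have E k : (k != 2)%N -> (k < 4)%N -> vcoord (grid_pt N (upd p 2%N 0%N)) k =
      vcoord (grid_pt N p) k.
    by move=> k1 k4; rewrite !vcoord_grid ?upd_neq.
  have E0' : vcoord (grid_pt N (upd p 2%N 0%N)) 2 = 0.
    by rewrite vcoord_grid // upd_eq mul0r.
  rewrite (fglue _ (grid_pt N (upd p 2%N 0%N)) false e2) ?addFb //.
  + by rewrite /test_map E0 E0' !E // unfold_base_other_cut.
  + by rewrite !E.
  + by rewrite E0 E0' !E //; exact: F2.
- have E0 : vcoord (grid_pt N p) 3 = 2 by rewrite vcoord_grid // pk top.
  have E k : (k != 3)%N -> (k < 4)%N -> vcoord (grid_pt N (upd p 3%N 0%N)) k =
      vcoord (grid_pt N p) k.
    by move=> k1 k4; rewrite !vcoord_grid ?upd_neq.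
  have E0' : vcoord (grid_pt N (upd p 3%N 0%N)) 3 = 0.
    by rewrite vcoord_grid // upd_eq mul0r.
  rewrite (fglue _ (grid_pt N (upd p 3%N 0%N)) false e3) ?addFb //.
  + by rewrite /test_map E0 E0' !E // unfold_base_other_cut2.
  + by rewrite !E.
  + by rewrite E0 E0' !E //; exact: F3.
Qed.

End ClassData.

Lemma fold_vec_fiber_continuous :
  continuous (fun x => fiber_vec (fold x) (fold_label x)).
Proof.
move=> x; apply: continuous_at_mx => i k.
pose cc (x : 'rV[R]_3) := if eps then tilt (x 0 c) else 1.
pose sc (x : 'rV[R]_3) := if eps then tent (x 0 c) else 0.
have -> : (fun x => fiber_vec (fold x) (fold_label x) i k) =
    (fun x : 'rV[R]_3 => [tuple tilt (x 0 b);
      tent (x 0 b) * (tilt (x 0 a) * cc x); tent (x 0 b) * (tent (x 0 a) * cc x);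
      tent (x 0 b) * (tilt (x 0 a) * sc x); tent (x 0 b) * (tent (x 0 a) * sc x)]`_k).
  by apply/funext => y; rewrite mxE !coil_fold !mxE.
have X j : {for x, continuous (fun x : 'rV[R]_3 => tent (x 0 j))}.
  exact: (continuous_compT (@coord_continuous R 1 3 0 j) (@tent_continuous R)).
have C j : {for x, continuous (fun x : 'rV[R]_3 => tilt (x 0 j))}.
  exact: (continuous_compT (@coord_continuous R 1 3 0 j) (@tilt_continuous R)).
have K (r : R) : {for x, continuous (fun x : 'rV[R]_3 => r)}.
  exact: cst_continuous.
have Cc : {for x, continuous cc} by rewrite /cc; case: eps; [exact: C|exact: K].
have Xc : {for x, continuous sc} by rewrite /sc; case: eps; [exact: X|exact: K].
case: k => [[|[|[|[|[|//]]]]] ?] /=; first exact: C.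
- exact: continuous_at_mul (X b) (continuous_at_mul (C a) Cc).
- exact: continuous_at_mul (X b) (continuous_at_mul (X a) Cc).
- exact: continuous_at_mul (X b) (continuous_at_mul (C a) Xc).
- exact: continuous_at_mul (X b) (continuous_at_mul (X a) Xc).
Qed.

Lemma fold_vec_circle_continuous j :
  continuous (fun x => @circle_vec R 3 j (fold x) (fold_label x)).
Proof.
move=> x; apply: continuous_at_mx => i k.
have -> : (fun x => circle_vec j (fold x) (fold_label x) i k) =
    (fun x : 'rV[R]_3 => [tuple tilt (x 0 j); tent (x 0 j)]`_k).
  by apply/funext => y; rewrite mxE coil_fold mxE.
case: k => [[|[|//]] ?] /=.
  exact: (continuous_compT (@coord_continuous R 1 3 0 j) (@tilt_continuous R)).
exact: (continuous_compT (@coord_continuous R 1 3 0 j) (@tent_continuous R)).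
Qed.

Definition box4 : set 'rV[R]_4 := [set v | forall j, `[0, 2]%classic (v ord0 j)].

(** A Lebesgue number argument in which the mesh and the condition [good] depend on the same [N]. *)
Lemma good_mesh (good : nat -> nat -> M * M -> Prop) (U : nat -> set (M * M)) :
  (forall z, exists2 i, (i < 4)%N & U i z) ->
  (forall i z0, U i z0 ->
     \forall w \near filter_prod (nbhs z0) \oo, good i w.2 w.1) ->
  exists N, forall v, box4 v -> exists2 i, (i < 4)%N &
    forall v' : 'rV[R]_4, (forall j, `|v' 0 j - v 0 j| <= N.+1%:R^-1) ->
      good i N (test_map v').
Proof.
move=> Ucov Unear.
have /compact_near_coveringP cov : compact box4.
  rewrite /box4; apply: (@rV_compact _ 4 (fun=> `[(0 : R), 2]%classic)) => _.
  exact: segment_compact.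
have := cov nat \oo (fun N v => exists2 i, (i < 4)%N &
    forall v' : 'rV[R]_4, (forall j, `|v' 0 j - v 0 j| <= N.+1%:R^-1) ->
      good i N (test_map v')) eventually_filter.
case=> [v0 _|N _ HN]; last by exists N; exact: (HN N (leqnn N)).
have [i i4 Uv0] := Ucov (test_map v0).
have [[S T] /= [Sz To] ST] := Unear i _ Uv0.
have /nbhs_ballP[e /= e0 eS] : nbhs v0 (test_map @^-1` S).
  exact: (@test_map_continuous v0 S Sz).
have e20 : 0 < e / 2 by rewrite divr_gt0.
exists (ball v0 (e / 2), T `&` [set N | N.+1%:R^-1 < e / 2 :> R]).
  split; first exact: nbhsx_ballx.
  by apply: filterI => //; exact: (near_infty_natSinv_lt (PosNum e20)).
move=> [v N] /= [[_ vv0] [TN Ne]]; exists i => // v' v'v.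
apply: (ST (_, _)); split => //=; apply: eS; split => // i' j.
have := vv0 i' j; rewrite ord1 /ball /= => vj.
rewrite [ltRHS]splitr -(subrKA (v 0 j)); apply: le_lt_trans (ler_normD _ _) _.
by rewrite ltrD // distrC; exact: le_lt_trans (v'v j) Ne.
Qed.

Lemma bott3_cover_ge5 k : motion_cover R M k -> (4 < k)%N.
Proof.
move=> [U [oU Ucov Upl]]; rewrite ltnNge; apply/negP => k4.
(* Empty sets pad the cover to four members, one for each zero-divisor; the fibre class serves
   members 0 and 1. *)
pose U' (i : nat) : set (M * M) := if insub i is Some i' then U i' else set0.
have oU' i : open (U' i) by rewrite /U'; case: insubP => *; [exact: oU|exact: open0].
have Upl' i : has_motion_planner R (U' i).
  rewrite /U'; case: insubP => [i' _ _|_]; first exact: Upl.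
  apply: (motion_planner_null (y := @bott_vertex R 3 A)).
  exists (fun w => set_val w.1); split => //.
    exact: (continuous_compT (@fst_continuous _ _) (@initial_continuous _ _ set_val)).
  by move=> x; have := set_valP x.
have U'cov z : exists2 i, (i < 4)%N & U' i z.
  have [i Uz] := Ucov z; exists i; first exact: leq_trans (ltn_ord i) k4.
  by rewrite /U' valK.
have [ab ac bc] := abc.
have [g0 [near0 f0]] := planner_sign fiber_vec_twisted fold_vec_fiber_continuous
  flips_fiber (oU' 0%N) (Upl' 0%N).
have [g1 [near1 f1]] := planner_sign fiber_vec_twisted fold_vec_fiber_continuous
  flips_fiber (oU' 1%N) (Upl' 1%N).
have [g2 [near2 f2]] := planner_sign (circle_vec_twisted ab)
  (@fold_vec_circle_continuous a) flips_base (oU' 2%N) (Upl' 2%N).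
have cb : c != b by rewrite eq_sym.
have [g3 [near3 f3]] := planner_sign (circle_vec_twisted cb)
  (@fold_vec_circle_continuous c) flips_other (oU' 3%N) (Upl' 3%N).
pose good i := nth g0 [:: g0; g1; g2; g3] i.
have [N HN] : exists N, forall v, box4 v -> exists2 i, (i < 4)%N &
    forall v' : 'rV[R]_4, (forall j, `|v' 0 j - v 0 j| <= N.+1%:R^-1) ->
      good i N (test_map v').
  apply: (@good_mesh good (fun i => if (i < 4)%N then U' i else set0)).
    by move=> z; have [i i4 Uz] := U'cov z; exists i => //; rewrite i4.
  by move=> [|[|[|[|i]]]] z0 //=; [exact: near0|exact: near1|exact: near2|exact: near3].
have [F0 [G0 C0]] := f0 N; have [F1 [G1 C1]] := f1 N.
have [F2 [G2 C2]] := f2 N; have [F3 [G3 C3]] := f3 N.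
have [p pN pF] := klein_torus_cell G0 G1 G2 G3.
have vbox : box4 (grid_pt N p).
  move=> j; have /andP[_ /ltnW pj] := pN j (ltn_ord j).
  rewrite /= in_itv /= mxE divr_ge0 //= ler_pdivrMr ?ltr0n //.
  by rewrite -natrM ler_nat mul2n.
have [i i4 gi] := HN _ vbox.
(* The segment from the centre to a point of the cell stays within the mesh, hence in the good set,
   so the sign function attached to [i] is constant on the cell. *)
have cell q t : in_cell [:: 0; 1; 2; 3]%N p q -> 0 <= t <= 1 ->
    good i N (test_map (grid_pt N p + t *: (grid_pt N q - grid_pt N p))).
  move=> pq /andP[t0 t1]; apply: gi => j; rewrite !mxE addrAC subrr add0r.
  rewrite normrM ger0_norm // -mulrBl normrM [`|_^-1|]ger0_norm ?invr_ge0 //.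
  rewrite mulrA ler_piMl ?invr_ge0 // mulr_ile1 //.
  have := pq j; rewrite (_ : nat_of_ord j \in _); last first.
    by case: j => [[|[|[|[|//]]]] ?].
  move=> [qp1 qp2]; have q1 : (q j)%:R <= (p j)%:R + 1 :> R by rewrite natr1 ler_nat.
  have q2 : (p j)%:R <= (q j)%:R + 1 :> R by rewrite natr1 ler_nat.
  by rewrite ler_norml; apply/andP; split; lra.
have const F : List.In F [:: F3; F2; F1; F0] -> 
    (forall v v', (forall t, 0 <= t <= 1 ->
       good i N (test_map (v + t *: (v' - v)))) -> F v = F v') -> False.
  move=> inF CF; apply: (pF (fun q => F (grid_pt N q))).
    by move: inF => /= [<-|[<-|[<-|[<-|//]]]]; tauto.
  exists (F (grid_pt N p)) => q pq; apply/esym/CF => t; exact: cell.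
move: i4 gi cell const; case: i => [|[|[|[|//]]]] _ _ _ const.
- by apply: (const F0) => //=; tauto.
- by apply: (const F1) => //=; tauto.
- by apply: (const F2) => //=; tauto.
- by apply: (const F3) => //=; tauto.
Qed.

End Threefold.

Lemma TC_bounds (R : realType) (Y : topologicalType) (k l : nat) :
  (forall i, motion_cover R Y i -> (k <= i)%N) -> motion_cover R Y l ->
  (k%:R%:E <= TC R Y <= l%:R%:E)%E.
Proof.
move=> kmin lcov; rewrite /TC; case: pselect => [ex|nex]; last first.
  by exfalso; apply: nex; exists l; exact/asboolP.
case: ex_minnP => i /asboolP icov imin; rewrite !lee_fin !ler_nat kmin //=.
by apply: imin; exact/asboolP.
Qed.

(** The off-diagonal entries 1 all lie in row [b], the fibre: one in column [a], the base, and one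
    in column [c] exactly when [eps] holds. *)
Lemma M3_TC_bounds (R : realType) (b12 b13 b23 : 'F_2) (a b c : 'I_3) (eps : bool) :
  [/\ a != b, a != c & b != c] ->
  (forall i j, bott3_mx b12 b13 b23 i j =
    ((i == j) || (i == b) && ((j == a) || eps && (j == c)))%:R) ->
  (5%:R%:E <= TC R (M3 R b12 b13 b23) <= 7%:R%:E)%E.
Proof.
move=> abc AE; apply: TC_bounds; last exact: bott_motion_cover.
by move=> i; exact: (bott3_cover_ge5 (eps := eps) abc).
Qed.

Theorem theorem4p10 (R : realType) :
  [/\ (5%:R%:E <= TC R (M3 R 1%R 0%R 0%R) <= 7%:R%:E)%E,
      (5%:R%:E <= TC R (M3 R 0%R 1%R 0%R) <= 7%:R%:E)%E,
      (5%:R%:E <= TC R (M3 R 0%R 0%R 1%R) <= 7%:R%:E)%E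
    & (5%:R%:E <= TC R (M3 R 0%R 1%R 1%R) <= 7%:R%:E)%E].
Proof.
pose o0 := @Ordinal 3 0 isT; pose o1 := @Ordinal 3 1 isT; pose o2 := @Ordinal 3 2 isT.
split.
- apply: (@M3_TC_bounds _ _ _ _ o0 o1 o2 false) => // i j.
  by rewrite mxE; case: i j => [[|[|[|//]]] ?] [[|[|[|//]]] ?]; exact/val_inj.
- apply: (@M3_TC_bounds _ _ _ _ o0 o2 o1 false) => // i j.
  by rewrite mxE; case: i j => [[|[|[|//]]] ?] [[|[|[|//]]] ?]; exact/val_inj.
- apply: (@M3_TC_bounds _ _ _ _ o1 o2 o0 false) => // i j.
  by rewrite mxE; case: i j => [[|[|[|//]]] ?] [[|[|[|//]]] ?]; exact/val_inj.
- apply: (@M3_TC_bounds _ _ _ _ o0 o2 o1 true) => // i j.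
  by rewrite mxE; case: i j => [[|[|[|//]]] ?] [[|[|[|//]]] ?]; exact/val_inj.
Qed.
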